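(* Let $\alpha\in\,]0,1]$ and $\beta\in\,]0,1[$, and let $U,V\subset\mathbb{R}^n$ be linear subspaces with $1\le \dim U\le \dim V\le n-1$, $U\neq U\cap V$ and $U\cap V\neq\{0\}$. Let $\theta_F$ be the Friedrichs angle between $U$ and $V$ and $c_F:=\cos\theta_F$. Then the AAMR operator $$T_{\alpha,\beta}:=(1-\alpha)I_n+\alpha(2\beta P_V-I_n)(2\beta P_U-I_n)$$ is linearly convergent to $P_{U^\perp\cap V^\perp}$ with any rate $\mu\in\,]\gamma(T_{\alpha,\beta}),1[$, where $$\gamma(T_{\alpha,\beta})=\begin{cases} 1-4\alpha\beta(1-\beta), & \text{if } 0\le c_F<c(\alpha,\beta);\\ \sqrt{4(1-\alpha)\alpha\beta^2c_F^2+(1-2\alpha\beta)^2}, & \text{if } c(\alpha,\beta)\le c_F<\widehat{c}_\beta;\\ 1+2\alpha\beta\left(\beta c_F^2-1+c_F\sqrt{\beta^2c_F^2-2\beta+1}\right), & \text{if } \widehat{c}_\beta\le c_F<1; \end{cases}$$ with $$\widehat{c}_\beta:=\frac{\sqrt{(2\beta-1)^+}}{\beta}\quad\text{and}\quad c(\alpha,\beta):=\begin{cases} \sqrt{\dfrac{\left(\left(1-4\alpha\beta(1-\beta)\right)^2-(1-2\alpha\beta)^2\right)^+}{4(1-\alpha)\alpha\beta^2}}, & \text{if } \alpha<1;\\ 0, & \text{if } \alpha=1. \end{cases}$$ Furthermore, $\gamma(T_{\alpha,\beta})$ is the optimal linear convergence rate of $T_{\alpha,\beta}$ if and only if $\beta\neq\frac{1}{1+\sin\theta_F}$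 or $\theta_F=\frac{\pi}{2}$.
   Context: The setting is $\mathbb{R}^n$ with the Euclidean inner product and norm. $P_C$ denotes the (orthogonal) projector onto a closed convex set $C$, $C^\perp$ the orthogonal complement, $I_n$ the $n\times n$ identity, and $x^+:=\max\{0,x\}$ for $x\in\mathbb{R}$. Projectors onto subspaces are identified with their $n\times n$ matrices. The Friedrichs angle between $U$ and $V$ is the angle $\theta_F\in\,]0,\frac{\pi}{2}]$ whose cosine is $$c_F(U,V):=\sup\{\langle u,v\rangle : u\in U\cap(U\cap V)^\perp,\ v\in V\cap(U\cap V)^\perp,\ \|u\|\le1,\ \|v\|\le1\}.$$ For a matrix $A\in\mathbb{C}^{n\times n}$ with spectrum (set of eigenvalues) $\sigma(A)$, define $$\gamma(A):=\max\{|\lambda| : \lambda\in\{0\}\cup\sigma(A)\setminus\{1\}\}.$$ With $\|\cdot\|$ the induced matrix norm, $A$ is linearly convergent to $A^\infty\in\mathbb{C}^{n\times n}$ with rate $\mu\in[0,1[$ if there exist a positive integer $k_0$ and some $M>0$ such that $\|A^k-A^\infty\|\le M\mu^k$ for all $k\ge k_0$; then $\mu$ is called a linear convergence rate of $A$. When the infimum of all the linear convergence rates of $A$ is itself a linear convergence rate, this minimum is called the optimal linear convergence rate of $A$. *)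

(* Defs.v *)
From HB Require Import structures.
From mathcomp Require Import all_boot all_order all_algebra.
From mathcomp Require Import all_classical all_reals all_analysis.
From mathcomp Require Import complex.

Set Implicit Arguments.
Unset Strict Implicit.
Unset Printing Implicit Defensive.
Import Order.TTheory GRing.Theory Num.Theory.
Local Open Scope classical_set_scope.
Local Open Scope ring_scope.

(* R^n is 'cV[R]_n, so that matrices act on the left as linear operators. *)

Section Euclidean.
Context {R : realType} {n : nat}.
Implicit Types (u v x p : 'cV[R]_n) (U V W : {vspace 'cV[R]_n}).

Definition dotv u v : R := \sum_(i < n) u i 0 * v i 0.

Definition l2norm v : R := Num.sqrt (dotv v v).

(* The kernel of the matrix whose rows are the vectors of a basis of U; the
   choice of the basis is irrelevant by [memv_orthoc] below. *)
Definition orthoc U : {vspace 'cV[R]_n} :=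
  lker (linfun (mulmx (\matrix_(i < \dim U, j < n) (vbasis U)`_i j 0))).

(* The nearest-point map of C; it takes the junk value 0 at the points without
   a nearest point in C. *)
Definition proj (C : set 'cV[R]_n) x : 'cV[R]_n :=
  xget 0 [set p | C p /\ forall c, C c -> l2norm (x - p) <= l2norm (x - c)].

(* The matrix whose j-th column is the projection of the j-th basis vector onto
   W; [projmxE] below shows that it does represent the projector. *)
Definition projmx W : 'M[R]_n :=
  \matrix_(i, j) proj [set w | w \in W] (delta_mx j 0) i 0.

Definition friedrichs_cos U V : R :=
  sup [set a | exists u v,
    [/\ u \in (U :&: orthoc (U :&: V))%VS, v \in (V :&: orthoc (U :&: V))%VS,
        l2norm u <= 1, l2norm v <= 1 & a = dotv u v]].

(* [acos] takes its values in [0, pi], hence in ]0, pi/2] for an argument in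
   [0, 1[. *)
Definition friedrichs_angle U V : R := acos (friedrichs_cos U V).

Definition aamr (alpha beta : R) U V : 'M[R]_n :=
  (1 - alpha)%:M +
  alpha *: (((2 * beta) *: projmx V - 1%:M) *m ((2 * beta) *: projmx U - 1%:M)).

End Euclidean.

Section LinearConvergence.
Context {R : realType} {n : nat}.
Implicit Types (A : 'M[R[i]]_n).

(* The norm of R[i] takes its values in R[i]; this is the modulus as a real. *)
Definition modulus (z : R[i]) : R := complex.Re `|z|.

Definition l2normC (x : 'cV[R[i]]_n) : R :=
  Num.sqrt (\sum_(i < n) modulus (x i 0) ^+ 2).

Definition opnorm A : R :=
  sup [set l2normC (A *m x) | x in [set x | l2normC x <= 1]].

(* The set of moduli is finite and non-empty, so its supremum is its maximum. *)
Definition gamma A : R :=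
  sup [set modulus l | l in [set 0] `|` [set l | eigenvalue A l] `\ 1].

Definition linearly_convergent A Ainf (mu : R) : Prop :=
  0 <= mu < 1 /\
  exists (k0 : nat) (M : R), [/\ (0 < k0)%N, 0 < M &
    forall k : nat, (k0 <= k)%N -> opnorm (A ^+ k - Ainf) <= M * mu ^+ k].

Definition convergence_rates A : set R :=
  [set mu | exists Ainf, linearly_convergent A Ainf mu].

Definition optimal_rate A (mu : R) : Prop :=
  convergence_rates A mu /\ mu = inf (convergence_rates A).

End LinearConvergence.

Section AAMRRate.
Context {R : realType}.
Implicit Types (alpha beta c : R).

Definition pospart (x : R) : R := Num.max 0 x.

Definition c_hat beta : R := Num.sqrt (pospart (2 * beta - 1)) / beta.

Definition c_thr alpha beta : R :=
  if alpha < 1 then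
    Num.sqrt (pospart ((1 - 4 * alpha * beta * (1 - beta)) ^+ 2
                       - (1 - 2 * alpha * beta) ^+ 2)
              / (4 * (1 - alpha) * alpha * beta ^+ 2))
  else 0.

(* Used for c in [0, 1[ only. *)
Definition aamr_rate alpha beta c : R :=
  if c < c_thr alpha beta then 1 - 4 * alpha * beta * (1 - beta)
  else if c < c_hat beta then
    Num.sqrt (4 * (1 - alpha) * alpha * beta ^+ 2 * c ^+ 2
              + (1 - 2 * alpha * beta) ^+ 2)
  else 1 + 2 * alpha * beta *
         (beta * c ^+ 2 - 1 + c * Num.sqrt (beta ^+ 2 * c ^+ 2 - 2 * beta + 1)).

End AAMRRate.

Section Facts.
Context {R : realType} {n : nat}.
Implicit Types (u v x p : 'cV[R]_n) (U V W : {vspace 'cV[R]_n}).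

Lemma dotvE u v : dotv u v = (u^T *m v) 0 0.
Proof. by rewrite mxE; apply: eq_bigr => i _; rewrite mxE. Qed.

Lemma dotvC u v : dotv u v = dotv v u.
Proof. by apply: eq_bigr => i _; rewrite mulrC. Qed.

Lemma dotvDl u v x : dotv (u + v) x = dotv u x + dotv v x.
Proof. by rewrite !dotvE linearD mulmxDl mxE. Qed.

Lemma dotvZl (a : R) u x : dotv (a *: u) x = a * dotv u x.
Proof. by rewrite !dotvE linearZ -scalemxAl mxE. Qed.

Lemma dotvv_ge0 v : 0 <= dotv v v.
Proof. by apply: sumr_ge0 => i _; rewrite -expr2 sqr_ge0. Qed.

Lemma dotvv_eq0 v : dotv v v = 0 -> v = 0.
Proof.
move=> /eqP; rewrite psumr_eq0; last by move=> i _; rewrite -expr2 sqr_ge0.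
move=> /allP v0; apply/colP => i; rewrite mxE; apply/eqP.
by have := v0 i (mem_index_enum i); rewrite /= mulf_eq0 orbb.
Qed.

Lemma memv_orthoc U v :
  v \in orthoc U <-> (forall u, u \in U -> dotv u v = 0).
Proof.
rewrite memv_ker lfunE /=; split=> [/eqP Bv0 u uU|orth].
  rewrite (coord_vbasis uU) dotvE linear_sum /= mulmx_suml summxE big1 // => i _.
  rewrite linearZ -scalemxAl mxE -dotvE.
  have /matrixP/(_ i 0) := Bv0; rewrite !mxE => Bi0.
  rewrite [dotv _ _](_ : _ = 0) ?mulr0// -[RHS]Bi0.
  by apply: eq_bigr => j _; rewrite mxE.
apply/eqP/matrixP => i j; rewrite ord1 !mxE -[RHS](orth (vbasis U)`_i).
  by apply: eq_bigr => k _; rewrite mxE.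
by apply/vbasis_mem/mem_nth; rewrite size_tuple.
Qed.

Lemma addv_orthoc U : (U + orthoc U)%VS = fullv.
Proof.
have dU : (U :&: orthoc U = 0)%VS.
  apply/eqP; rewrite -subv0; apply/subvP => v; rewrite memv_cap memv0.
  by move=> /andP[vU /memv_orthoc/(_ _ vU) /dotvv_eq0 ->].
apply/eqP; rewrite -dimv_leqif_eq ?subvf//= dimv_disjoint_sum//.
apply/eqP/anti_leq; apply/andP; split.
  by rewrite -(dimv_disjoint_sum dU) dimvS ?subvf.
rewrite -[X in (X <= _)%N](limg_ker_dim
  (linfun (mulmx (\matrix_(i < \dim U, j < n) (vbasis U)`_i j 0)))).
rewrite capfv addnC leq_add2r.
by apply: leq_trans (dimvS (subvf _)) _; rewrite dimvf /dim /= muln1.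
Qed.

Lemma proj_vspaceP W x p :
  p \in W -> x - p \in orthoc W -> proj [set w | w \in W] x = p.
Proof.
move=> pW /memv_orthoc xpW.
have pyth w : w \in W -> dotv (x - w) (x - w) =
    dotv (x - p) (x - p) + dotv (p - w) (p - w).
  move=> wW; have -> : x - w = (x - p) + (p - w) by rewrite addrA subrK.
  have pwO : dotv (p - w) (x - p) = 0 by apply: xpW; rewrite memvB.
  move: (x - p) (p - w) pwO => a b ba0.
  rewrite dotvDl [dotv a (a + b)]dotvC [dotv b (a + b)]dotvC.
  by rewrite !dotvDl ba0 [dotv a b]dotvC ba0 addr0 add0r.
apply: xget_unique => [|q [/= qW /(_ p pW)]].
  split=> //= c cW; rewrite /l2norm ler_sqrt ?dotvv_ge0// (pyth c)// lerDl.
  exact: dotvv_ge0.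
rewrite /l2norm ler_sqrt ?dotvv_ge0// (pyth q)// gerDl => pq0.
have /dotvv_eq0/eqP : dotv (p - q) (p - q) = 0.
  by apply/eqP; rewrite eq_le pq0 dotvv_ge0.
by rewrite subr_eq0 => /eqP.
Qed.

Lemma proj_vspace_exists W x :
  exists2 p, p \in W & x - p \in orthoc W.
Proof.
have /memv_addP[p pW [q qW xE]] : x \in (W + orthoc W)%VS.
  by rewrite addv_orthoc memvf.
by exists p => //; rewrite xE addrAC subrr add0r.
Qed.

Lemma projmxE W x : projmx W *m x = proj [set w | w \in W] x.
Proof.
apply/esym/proj_vspaceP; last first.
  have xE : x = \sum_(j < n) x j 0 *: delta_mx j 0.
    rewrite {1}[x]matrix_sum_delta; apply: eq_bigr => j _.
    by rewrite big_ord1.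
  have -> : x - projmx W *m x = \sum_(j < n)
      x j 0 *: (delta_mx j 0 - proj [set w | w \in W] (delta_mx j 0)).
    rewrite [X in X - _]xE; apply/colP => i.
    rewrite !mxE !summxE -sumrB; apply: eq_bigr => j _.
    by rewrite !mxE mulrBr [in X in _ - X]mulrC.
  apply: memv_suml => j _; apply: memvZ.
  have [p pW xpW] := proj_vspace_exists W (delta_mx j 0).
  by rewrite (proj_vspaceP pW xpW).
have -> : projmx W *m x = \sum_(j < n)
    x j 0 *: proj [set w | w \in W] (delta_mx j 0).
  apply/colP => i; rewrite mxE summxE; apply: eq_bigr => j _.
  by rewrite !mxE mulrC.
apply: memv_suml => j _; apply: memvZ.
have [p pW xpW] := proj_vspace_exists W (delta_mx j 0).
by rewrite (proj_vspaceP pW xpW).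
Qed.

End Facts.

(* Main.v *)
Require Import Defs.
From mathcomp Require Import all_boot all_order all_algebra.
From mathcomp Require Import all_classical all_reals all_analysis.
From mathcomp Require Import complex.
From mathcomp Require Import ring lra.

(** Let P and Q be the projectors onto U and V, D = P - Q and J = 1 - P - Q.
    These symmetric matrices anticommute, and S = D^2 = 1 - J^2 commutes with
    both of them; on the plane where a line of U and a line of V make an angle
    t, S is the scalar sin(t)^2.  The AAMR operator becomes

      T = (1 - 2 alpha beta) + 2 alpha beta^2 (1 - S) + 2 alpha beta N,
      N = (beta D + (1 - beta)) J,

    and N^2 is a polynomial in S because J and D anticommute.  So no choice of
    principal vectors is needed: on the eigenspace of S for the eigenvalue
    s = 1 - c^2, T minus the scalar [block_mean] squares to a scalar, and its
    eigenvalues are the two roots of an explicit quadratic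
    ([block_factorization], [aamr_spectrum]).  The larger modulus of the roots
    is [block_radius], a nondecreasing function of c.  For s = 0 the roots are
    1, on the intersection of the orthogonal complements, and
    rho = 1 - 4 alpha beta (1 - beta), on the intersection of U and V.

    The Friedrichs cosine is sqrt (1 - s) for the least positive eigenvalue s
    of S ([friedrichs_cosE]): if u is a vector of U orthogonal to the kernel of
    S, then |Q u|^2 = |u|^2 - <u, S u>.  Hence gamma T is the maximum of rho
    and of [block_radius] at the Friedrichs cosine ([gamma_aamr]), and
    comparing the two terms gives the three cases of the formula
    ([aamr_rateE]).

    The spectral resolution of S splits T^k into finitely many pieces, and each
    of them is bounded by one geometric sequence when its two roots differ, and
    by every larger one otherwise ([aamr_decays]).  Conversely a rate is never
    below the modulus of an eigenvalue other than 1 ([rate_ge_modulus]), and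
    gamma T is not a rate if an eigenvalue of that modulus has a Jordan block,
    which makes T^k minus its limit behave like k (gamma T)^k ([jordan_modulus_not_rate]).  The
    two roots of an eigenspace with 0 < s < 1 coincide exactly when the
    discriminant beta^2 c^2 - 2 beta + 1 vanishes; then N is not scalar
    ([pturn_not_scalar]) and there is a Jordan block.  At the Friedrichs cosine
    this is the equation beta = 1 / (1 + sin theta_F) ([block_disc_sin]); at a
    smaller c the block has radius below gamma T, as [block_radius] increases
    strictly from there on.  For c = 0 the matrix N vanishes and there is no
    Jordan block, which is the exception theta_F = pi / 2. *)

Import Order.TTheory GRing.Theory Num.Theory.
Local Open Scope classical_set_scope.
Local Open Scope ring_scope.

Set Implicit Arguments.
Unset Strict Implicit.
Unset Printing Implicit Defensive.

(** * Spectral resolution of a real symmetric matrix *)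

(** Both sides agree at the [size rs] points of [rs] and have degree less than
    [size rs]. *)
Lemma lagrange_partition_of_unity (F : fieldType) (rs : seq F) :
  uniq rs -> (0 < size rs)%N ->
  \sum_(r <- rs) (\prod_(x <- rs | x != r) (r - x))^-1
     *: \prod_(x <- rs | x != r) ('X - x%:P) = 1 :> {poly F}.
Proof.
move=> urs rs0; apply/eqP; rewrite -subr_eq0; apply/eqP.
apply: (@roots_geq_poly_eq0 _ _ rs) => //.
  apply/allP => y yrs; rewrite /root hornerD hornerN hornerC horner_sum.
  rewrite (bigD1_seq y) //= [\sum_(i <- rs | _) _]big1_seq => [|r /andP[rNy rrs]].
    rewrite hornerZ horner_prod addr0.
    under [X in _^-1 * X]eq_bigr do rewrite hornerXsubC.
    rewrite mulVf ?subrr //.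
    rewrite prodf_seq_neq0; apply/allP => x _; apply/implyP => xNy.
    by rewrite subr_eq0 eq_sym.
  apply/eqP; rewrite hornerZ mulf_eq0 horner_prod prodf_seq_eq0.
  apply/orP; right; apply/hasP; exists y => //.
  by rewrite hornerXsubC subrr eqxx andbT eq_sym.
apply: (leq_trans (size_polyD _ _)); rewrite geq_max size_polyN size_poly1 rs0.
rewrite andbT; apply: (leq_trans (size_sum _ _ _)).
apply/bigmax_leqP_seq => r rrs _; apply: (leq_trans (size_scale_leq _ _)).
rewrite -big_filter size_prod_XsubC size_filter -[X in (_ < X)%N](count_predC (pred1 r)).
by rewrite count_uniq_mem // rrs add1n.
Qed.

(** Over the complex numbers the matrix is Hermitian, hence diagonalizable with
    real eigenvalues; the polynomial that vanishes at these eigenvalues is real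
    and kills the matrix already over the reals. *)
Lemma symmetric_split_annihilator {R : realType} {n : nat} (S : 'M[R]_n.+1) :
  S^T = S ->
  exists2 rs : seq R, uniq rs & horner_mx S (\prod_(r <- rs) ('X - r%:P)) = 0.
Proof.
move=> Ssym; pose f := real_complex R; pose A := map_mx f S.
have Areal : A \is a mxOver Num.real.
  by apply/mxOverP => i j; rewrite mxE; apply/complex_realP; exists (S i j).
have Aherm : A \is hermsymmx.
  apply: realsym_hermsym => //; apply/is_hermitianmxP.
  by rewrite expr0 scale1r map_mx_id // /A map_trmx Ssym.
have Anormal := hermitian_normalmx Aherm.
have /mxOverP dreal := hermitian_spectral_diag_real Aherm.
pose rs := undup [seq complex.Re (spectral_diag A 0 i) | i <- enum 'I_n.+1].
exists rs; first exact: undup_uniq.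
apply: (@map_mx_inj _ _ f); rewrite map_horner_mx -/A map_mx0.
rewrite (orthomx_spectralP Anormal) horner_mx_uconjC; last exact: spectral_unit.
rewrite horner_mx_diag (_ : map_mx _ _ = 0) ?linear0 ?mulmx0 ?mul0mx //.
apply/rowP => i; rewrite !mxE rmorph_prod horner_prod /=.
rewrite (bigD1_seq (complex.Re (spectral_diag A 0 i))) ?undup_uniq //=; last first.
  by rewrite mem_undup; apply/mapP; exists i => //; rewrite mem_enum.
rewrite rmorphB /= map_polyX map_polyC hornerXsubC /= (RRe_real (dreal 0 i)).
by rewrite subrr mul0r.
Qed.

(** The matrices [E r] are the orthogonal projectors onto the eigenspaces of
    [S], and they are nonzero, so that [rs] lists the eigenvalues. *)
Definition spectral_resolution {R : realType} {n : nat} (S : 'M[R]_n)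
    (rs : seq R) (E : R -> 'M[R]_n) : Prop :=
  \sum_(r <- rs) E r = 1%:M /\
  forall r, r \in rs ->
    [/\ E r != 0, S *m E r = r *: E r, (E r)^T = E r & E r *m E r = E r].

Lemma mulmx_cV_inj {R : pzSemiRingType} {m n : nat} (A B : 'M[R]_(m, n)) :
  (forall x : 'cV[R]_n, A *m x = B *m x) -> A = B.
Proof.
move=> AB; apply/matrixP => i j.
by have /matrixP/(_ i 0) := AB (delta_mx j 0); rewrite -!colE !mxE.
Qed.

Lemma resolution_eigenvector {R : realType} {n : nat} (S : 'M[R]_n) rs E r :
  spectral_resolution S rs E -> r \in rs ->
  exists2 x : 'cV[R]_n, S *m x = r *: x & x != 0.
Proof.
move=> [_ res] /res[/eqP Er0 SE _ _].
apply/not_exists2P => h; apply: Er0; apply: mulmx_cV_inj => x.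
rewrite mul0mx; have [|/negP/negPn/eqP //] := h (E r *m x).
by rewrite mulmxA SE scalemxAl.
Qed.

(** [E r] is the Lagrange polynomial at [r] evaluated at the matrix. *)
Lemma symmetric_spectral_resolution {R : realType} {n : nat} (S : 'M[R]_n.+1) :
  S^T = S ->
  exists rs E, spectral_resolution S rs E.
Proof.
move=> Ssym; have [rs urs ann] := symmetric_split_annihilator Ssym.
have rs0 : (0 < size rs)%N.
  case: rs urs ann => // _ /eqP; by rewrite big_nil rmorph1 oner_eq0.
pose L r := (\prod_(x <- rs | x != r) (r - x))^-1
  *: \prod_(x <- rs | x != r) ('X - x%:P).
have L1 : \sum_(r <- rs) L r = 1 by exact: lagrange_partition_of_unity.
pose E r := horner_mx S (L r).
have E1 : \sum_(r <- rs) E r = 1 by rewrite -(rmorph1 (horner_mx S)) -L1 raddf_sum.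
have SE r : r \in rs -> S *m E r = r *: E r.
  move=> rrs; apply/eqP; rewrite -subr_eq0; apply/eqP.
  have -> : S *m E r - r *: E r = horner_mx S (('X - r%:P) * L r).
    rewrite rmorphM rmorphB /= horner_mx_X horner_mx_C.
    by rewrite mulrBl -[_%:M * _]/(_ *m _) mul_scalar_mx.
  rewrite -scalerAr linearZ /= [in X in X = _](_ : _ * _ = \prod_(x <- rs) ('X - x%:P)).
    by rewrite ann scaler0.
  by rewrite [RHS](bigD1_seq r).
have Esym r : (E r)^T = E r.
  rewrite /E; elim/poly_ind: (L r) => [|p c IH]; first by rewrite rmorph0 trmx0.
  rewrite rmorphD rmorphM /= horner_mx_X horner_mx_C linearD /= tr_scalar_mx.
  rewrite trmx_mul IH Ssym; congr (_ + _).
  by apply: comm_mx_horner.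
(* Eigenvectors of a symmetric matrix for distinct eigenvalues are orthogonal;
   with the partition of unity this makes [E r] idempotent. *)
have Eorth r s : r \in rs -> s \in rs -> s != r -> E r *m E s = 0.
  move=> rrs srs sNr; apply/eqP.
  have : s *: (E r *m E s) = r *: (E r *m E s).
    rewrite scalemxAr -SE // mulmxA scalemxAl -SE //; congr (_ *m _).
    by rewrite -[LHS]trmxK trmx_mul Esym Ssym SE // linearZ /= Esym.
  move/eqP; rewrite -subr_eq0 -scalerBl scaler_eq0 subr_eq0.
  by rewrite (negbTE sNr).
exists [seq r <- rs | E r != 0], E; split.
  rewrite big_filter -[RHS]E1 big_mkcond /=; apply: eq_bigr => r _.
  by case: eqP => //= ->.
move=> r; rewrite mem_filter => /andP[Er0 rrs]; split=> //; first exact: SE.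
rewrite -[RHS]mulr1 -E1 mulr_sumr (bigD1_seq r) //=.
rewrite big1_seq ?addr0 // => s /andP[sNr srs]; exact: Eorth.
Qed.

(** * The moduli of the roots as functions of the cosine *)

Lemma lt_sqrtr_ge0 {R : rcfType} (x m : R) :
  0 <= x -> (x < Num.sqrt m) = (x ^+ 2 < m).
Proof.
move=> x0; have [m0|m0] := ltP 0 m.
  by rewrite -{1}(ger0_norm x0) -sqrtr_sqr ltr_sqrt.
rewrite ler0_sqrtr // ltNge x0; apply/esym/negbTE; rewrite -leNgt.
exact: le_trans m0 (sqr_ge0 _).
Qed.

(** With c^2 = 1 - s, these describe the quadratic satisfied by the AAMR
    operator on the eigenspace of [psin2] for s.  Its roots are
    mean + (2 alpha beta) w and mean - (2 alpha beta) w with w^2 = c^2 disc;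
    [block_det] is their product, hence their common squared modulus when they
    are not real, and [block_radius] is, for c >= 0, the larger of their
    moduli. *)
Definition block_disc {R : realType} (beta c : R) : R :=
  beta ^+ 2 * c ^+ 2 - 2 * beta + 1.

Definition block_mean {R : realType} (alpha beta c : R) : R :=
  1 - 2 * alpha * beta + 2 * alpha * beta ^+ 2 * c ^+ 2.

Definition block_det {R : realType} (alpha beta c : R) : R :=
  4 * (1 - alpha) * alpha * beta ^+ 2 * c ^+ 2 + (1 - 2 * alpha * beta) ^+ 2.

Definition block_radius {R : realType} (alpha beta c : R) : R :=
  if block_disc beta c < 0 then Num.sqrt (block_det alpha beta c)
  else block_mean alpha beta c
       + 2 * alpha * beta * c * Num.sqrt (block_disc beta c).

Section ScalarRates.
Context {R : realType} {alpha beta : R}.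
Hypotheses (halpha : 0 < alpha <= 1) (hbeta : 0 < beta < 1).
Implicit Types (c : R).

Local Notation rho := (1 - 4 * alpha * beta * (1 - beta)).

Let a0 : 0 < alpha. Proof. by case/andP: halpha. Qed.
Let a1 : alpha <= 1. Proof. by case/andP: halpha. Qed.
Let b0 : 0 < beta. Proof. by case/andP: hbeta. Qed.
Let b1 : beta < 1. Proof. by case/andP: hbeta. Qed.
Let ab0 : 0 < alpha * beta. Proof. exact: mulr_gt0. Qed.

Lemma lt_c_hat c : 0 <= c -> (c < c_hat beta) = (block_disc beta c < 0).
Proof.
move=> c0; rewrite /c_hat ltr_pdivlMr // lt_sqrtr_ge0; last first.
  by rewrite mulr_ge0 // ltW.
have x0 : 0 <= (c * beta) ^+ 2 by exact: sqr_ge0.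
rewrite /pospart lt_max ltNge x0 /= /block_disc.
by apply/idP/idP => h; rewrite exprMn in h x0 *; lra.
Qed.

Lemma rho_ge0 : 0 <= rho.
Proof.
have : alpha * (4 * beta * (1 - beta)) <= 1 * 1.
  apply: ler_pM; rewrite ?(ltW a0) //.
    by rewrite !mulr_ge0 ?subr_ge0 // ltW.
  by have := sqr_ge0 (2 * beta - 1); lra.
lra.
Qed.

Lemma rho_lt1 : rho < 1.
Proof. have := mulr_gt0 ab0 (_ : 0 < 1 - beta); rewrite subr_gt0 => /(_ b1); lra. Qed.

(** The threshold is the point where the squared modulus of non-real roots
    reaches rho^2.  For alpha = 1 that modulus is the constant |1 - 2 beta|,
    never below rho = (1 - 2 beta)^2, in accordance with a zero threshold. *)
Lemma rho_ltE c : 0 <= c ->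
  (c < c_thr alpha beta) = (block_det alpha beta c < rho ^+ 2).
Proof.
move=> c0; rewrite /c_thr /block_det.
have c20 : 0 <= c ^+ 2 by exact: sqr_ge0.
have b20 : 0 < beta ^+ 2 by exact: exprn_gt0.
case: ifPn => [alt|]; last first.
  rewrite -leNgt => age; have -> : alpha = 1 by apply/eqP; rewrite eq_le a1 age.
  rewrite ltNge c0 /=; apply/esym/negbTE; rewrite -leNgt subrr mulr0 !mul0r add0r.
  rewrite -subr_ge0; have -> : (1 - 2 * 1 * beta) ^+ 2 - (1 - 4 * 1 * beta * (1 - beta)) ^+ 2
    = (1 - 2 * beta) ^+ 2 * (4 * beta * (1 - beta)) by ring.
  by rewrite mulr_ge0 ?sqr_ge0 // !mulr_ge0 ?subr_ge0 // ltW.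
have K0 : 0 < 4 * (1 - alpha) * alpha * beta ^+ 2.
  by rewrite ?mulr_gt0 ?subr_gt0 ?ltr0n.
rewrite lt_sqrtr_ge0 // ltr_pdivlMr // /pospart lt_max.
have -> : (c ^+ 2 * (4 * (1 - alpha) * alpha * beta ^+ 2) < 0) = false.
  by apply/negbTE; rewrite -leNgt mulr_ge0 // ltW.
by apply/idP/idP => h; lra.
Qed.

Lemma block_meanE c : block_mean alpha beta c =
  1 - 2 * alpha * beta + 2 * alpha * (beta ^+ 2 * c ^+ 2).
Proof. by rewrite /block_mean; ring. Qed.

Lemma block_detE c : block_det alpha beta c =
  4 * (1 - alpha) * alpha * (beta ^+ 2 * c ^+ 2) + (1 - 2 * alpha * beta) ^+ 2.
Proof. by rewrite /block_det; ring. Qed.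

(** A nonnegative discriminant gives x >= 2 beta - 1 for x = (beta c)^2 >= 0, so
    2 x >= 2 beta - 1, and the mean is 1 - alpha + alpha (2 x - 2 beta + 1). *)
Lemma block_mean_ge c : 0 <= block_disc beta c -> 1 - alpha <= block_mean alpha beta c.
Proof.
rewrite block_meanE /block_disc => h.
have : 0 <= beta ^+ 2 * c ^+ 2 by rewrite mulr_ge0 ?sqr_ge0.
move: h; set x := beta ^+ 2 * c ^+ 2 => h x0.
have : 0 <= alpha * (2 * x - (2 * beta - 1)) by rewrite mulr_ge0 ?(ltW a0) //; lra.
lra.
Qed.

Lemma block_mean_ge0 c : 0 <= block_disc beta c -> 0 <= block_mean alpha beta c.
Proof. by move=> /block_mean_ge; apply: le_trans; rewrite subr_ge0. Qed.

Lemma block_mean_gt0 c : c != 0 -> block_disc beta c = 0 ->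
  0 < block_mean alpha beta c.
Proof.
move=> cN0; rewrite block_meanE /block_disc => h.
have : 0 < beta ^+ 2 * c ^+ 2.
  by rewrite mulr_gt0 ?(exprn_gt0 _ b0) // lt_def sqrf_eq0 cN0 sqr_ge0.
move: h; set x := beta ^+ 2 * c ^+ 2 => h x0.
have : 0 < alpha * (2 * beta - 1) by rewrite mulr_gt0 //; lra.
have := a1; have -> : x = 2 * beta - 1 by lra.
lra.
Qed.

Lemma rho_le_mean c : 0 <= block_disc beta c -> rho <= block_mean alpha beta c.
Proof.
rewrite block_meanE /block_disc => h.
have : 0 <= beta ^+ 2 * c ^+ 2 by rewrite mulr_ge0 ?sqr_ge0.
move: h; set x := beta ^+ 2 * c ^+ 2 => h x0.
have : 0 <= alpha * (x + beta * (1 - 2 * beta)).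
  rewrite mulr_ge0 ?(ltW a0) //; have [bh|bh] := leP (2 * beta) 1.
    by rewrite addr_ge0 // mulr_ge0 ?subr_ge0 // ltW.
  have : 0 <= (1 - beta) * (2 * beta - 1) by rewrite mulr_ge0 // subr_ge0 ltW.
  lra.
lra.
Qed.

(** With real roots, [c] lies beyond the threshold.  As a function of
    x = (beta c)^2 the determinant increases, so it suffices to look at the
    least admissible x, which is 0 or 2 beta - 1. *)
Lemma rho2_le_det c : 0 <= block_disc beta c -> rho ^+ 2 <= block_det alpha beta c.
Proof.
rewrite block_detE /block_disc => h.
have : 0 <= beta ^+ 2 * c ^+ 2 by rewrite mulr_ge0 ?sqr_ge0.
move: h; set x := beta ^+ 2 * c ^+ 2 => h x0.
have r0 := rho_ge0.
have k0 : 0 <= (1 - alpha) * alpha by rewrite mulr_ge0 ?subr_ge0 // ltW.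
have [bh|bh] := leP (2 * beta) 1.
  have : rho ^+ 2 <= (1 - 2 * alpha * beta) ^+ 2.
    apply: lerXn2r; rewrite ?nnegrE //; first by nra.
    have : 0 <= alpha * beta * (1 - 2 * beta) by rewrite mulr_ge0 ?(ltW ab0) //; lra.
    lra.
  have : 0 <= (1 - alpha) * alpha * x by rewrite mulr_ge0.
  lra.
have : rho ^+ 2 <= (1 - 2 * alpha * (1 - beta)) ^+ 2.
  have : 0 <= alpha * (1 - beta) * (2 * beta - 1).
    by rewrite !mulr_ge0 ?subr_ge0 // ltW.
  move=> h1; apply: lerXn2r; rewrite ?nnegrE //; last lra.
  by apply: le_trans r0 _; lra.
have : 0 <= (1 - alpha) * alpha * (x - (2 * beta - 1)) by rewrite mulr_ge0 //; lra.
lra.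
Qed.

Lemma block_det_ge0 c : 0 <= block_det alpha beta c.
Proof.
apply: addr_ge0; last exact: sqr_ge0.
do 2![apply: mulr_ge0; last exact: sqr_ge0].
by rewrite !mulr_ge0 ?subr_ge0 // ltW.
Qed.

Lemma aamr_rateE c : 0 <= c ->
  aamr_rate alpha beta c = Num.max rho (block_radius alpha beta c).
Proof.
move=> c0; have r0 := rho_ge0; have d0 := block_det_ge0 c.
rewrite /aamr_rate rho_ltE // lt_c_hat // /block_radius -/(block_det _ _ _).
case: (ltP (block_disc beta c) 0) => hd.
  have rE : rho = Num.sqrt (rho ^+ 2) by rewrite sqrtr_sqr ger0_norm.
  case: ltP => h.
    by rewrite max_l // rE ler_wsqrtr // ltW.
  by rewrite max_r // rE ler_wsqrtr.
rewrite ltNge rho2_le_det //= max_r.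
  by rewrite /block_mean /block_disc; ring.
apply: le_trans (rho_le_mean hd) _; rewrite lerDl.
by rewrite !mulr_ge0 ?sqrtr_ge0 // ltW.
Qed.

Lemma block_radius_lt1 c : 0 <= c < 1 -> block_radius alpha beta c < 1.
Proof.
move=> /andP[c0 c1]; have c21 : c ^+ 2 < 1 by rewrite expr_lt1.
have b20 : 0 < beta ^+ 2 by exact: exprn_gt0.
rewrite /block_radius; case: (ltP (block_disc beta c) 0) => hd.
  apply: (@lt_le_trans _ _ (Num.sqrt 1)); last by rewrite sqrtr1.
  rewrite ltr_sqrt ?ltr01 // /block_det.
  have := rho_lt1.
  have : 0 <= (1 - alpha) * alpha * (beta ^+ 2 * (1 - c ^+ 2)).
    by rewrite !mulr_ge0 ?subr_ge0 ?(ltW a0) ?(ltW b20) // ltW.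
  lra.
rewrite /block_mean.
suff : c * Num.sqrt (block_disc beta c) < 1 - beta * c ^+ 2.
  move=> h; have := mulr_gt0 ab0 (_ : 0 < 1 - beta * c ^+ 2 - c * Num.sqrt (block_disc beta c)).
  by rewrite subr_gt0 => /(_ h); lra.
have c20 : 0 <= c ^+ 2 by exact: sqr_ge0.
rewrite -(@ltr_pXn2r _ 2) ?nnegrE ?mulr_ge0 ?sqrtr_ge0 //; last first.
  by rewrite subr_ge0 mulr_ile1 // ltW.
rewrite exprMn sqr_sqrtr // /block_disc.
have : 0 < (1 - c ^+ 2) by lra.
lra.
Qed.

(** Both the mean and the discriminant increase with [c]. *)
Lemma block_radius_lt c c' : 0 <= c -> c < c' -> 0 <= block_disc beta c ->
  block_radius alpha beta c < block_radius alpha beta c'.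
Proof.
move=> c0 cc' hd; have cc2 : c ^+ 2 < c' ^+ 2 by rewrite ltrXn2r.
have b20 : 0 < beta ^+ 2 by exact: exprn_gt0.
have dd : block_disc beta c <= block_disc beta c'.
  by rewrite /block_disc !lerD // ler_wpM2l // ltW.
rewrite /block_radius !(@ltNge _ _ (block_disc _ _) 0) hd (le_trans hd dd) /=.
apply: ltr_leD; first by rewrite /block_mean ltrD2l ltr_pM2l // !mulr_gt0.
apply: ler_pM; rewrite ?sqrtr_ge0 ?ler_wsqrtr //.
  by rewrite !mulr_ge0 // ltW.
by rewrite ler_wpM2l ?ltW // !mulr_gt0.
Qed.

(** When the roots turn from non-real to real between [c] and [c'], the two
    radii are separated by 1 - 2 alpha (1 - beta), the value of the double root
    at the cosine where the discriminant vanishes. *)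
Lemma block_radius_le c c' : 0 <= c -> c <= c' ->
  block_radius alpha beta c <= block_radius alpha beta c'.
Proof.
move=> c0; rewrite le_eqVlt => /predU1P[->|cc'] //.
have [hd|hd] := ltP (block_disc beta c) 0; last by exact/ltW/block_radius_lt.
have cc2 : c ^+ 2 < c' ^+ 2 by rewrite ltrXn2r.
have b20 : 0 < beta ^+ 2 by exact: exprn_gt0.
rewrite /block_radius hd; case: (ltP (block_disc beta c') 0) => hd'.
  rewrite ler_wsqrtr // lerD2r ler_wpM2l ?(ltW cc2) //.
  by rewrite !mulr_ge0 ?subr_ge0 // ltW.
have t0 := block_mean_ge0 hd'.
apply: (@le_trans _ _ (block_mean alpha beta c')); last first.
  by rewrite lerDl !mulr_ge0 ?sqrtr_ge0 // ltW // (le_lt_trans c0).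
rewrite -[X in _ <= X]ger0_norm // -sqrtr_sqr ler_wsqrtr //.
move: hd hd'; rewrite block_detE block_meanE /block_disc.
have : 0 <= beta ^+ 2 * c ^+ 2 by rewrite mulr_ge0 ?sqr_ge0.
set x := beta ^+ 2 * c ^+ 2; set y := beta ^+ 2 * c' ^+ 2 => x0 hx hy.
have k0 : 0 <= (1 - alpha) * alpha * (2 * beta - 1 - x).
  by rewrite !mulr_ge0 ?subr_ge0 ?(ltW a0) //; lra.
apply: (@le_trans _ _ ((1 - 2 * alpha * (1 - beta)) ^+ 2)); first by lra.
have h1 : 0 <= 1 - 2 * alpha * (1 - beta).
  have : 0 <= alpha * (2 * beta - 1) by rewrite mulr_ge0 ?(ltW a0) //; lra.
  have := a1; lra.
have h2 : 1 - 2 * alpha * (1 - beta) <= 1 - 2 * alpha * beta + 2 * alpha * y.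
  have : 0 <= alpha * (y - (2 * beta - 1)) by rewrite mulr_ge0 ?(ltW a0) //; lra.
  lra.
by apply: lerXn2r; rewrite ?nnegrE // (le_trans h1).
Qed.

End ScalarRates.

(** * Matrix norms and geometric decay of matrix powers *)

Section Modulus.
Context {R : realType}.
Implicit Types (z w : R[i]).

Lemma modulusE z : modulus z = Num.sqrt (complex.Re z ^+ 2 + complex.Im z ^+ 2).
Proof. by rewrite /modulus normc_def. Qed.

Lemma modulus_norm z : (modulus z)%:C%C = `|z|.
Proof. by rewrite /modulus normc_def. Qed.

Lemma modulus_ge0 z : 0 <= modulus z.
Proof. by rewrite modulusE sqrtr_ge0. Qed.

Lemma modulus_real (x : R) : modulus x%:C%C = `|x|.
Proof. by rewrite modulusE /= expr0n /= addr0 sqrtr_sqr. Qed.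

Lemma modulus0 : modulus (0 : R[i]) = 0.
Proof. by rewrite /modulus normr0. Qed.

Lemma modulus1 : modulus (1 : R[i]) = 1.
Proof. by rewrite /modulus normr1. Qed.

Lemma modulus_eq0 z : modulus z = 0 -> z = 0.
Proof. by move=> z0; apply/eqP; rewrite -normr_eq0 -modulus_norm z0. Qed.

Lemma modulusN z : modulus (- z) = modulus z.
Proof. by rewrite /modulus normrN. Qed.

Lemma modulusM z w : modulus (z * w) = modulus z * modulus w.
Proof. by apply: complexI; rewrite rmorphM /= !modulus_norm normrM. Qed.

Lemma modulusX z k : modulus (z ^+ k) = modulus z ^+ k.
Proof. by apply: complexI; rewrite rmorphXn /= !modulus_norm normrX. Qed.

Lemma modulusD z w : modulus (z + w) <= modulus z + modulus w.
Proof. by rewrite -lecR rmorphD /= !modulus_norm ler_normD. Qed.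

Lemma modulus_sum (I : Type) (r : seq I) (F : I -> R[i]) :
  modulus (\sum_(i <- r) F i) <= \sum_(i <- r) modulus (F i).
Proof.
elim: r => [|i r IH]; first by rewrite !big_nil modulus0.
by rewrite !big_cons; apply: le_trans (modulusD _ _) _; rewrite lerD2l.
Qed.

End Modulus.

(** The power function lies above its tangent at [b], and the constant term of
    the tangent is nonnegative. *)
Lemma ler_pow_bernoulli {R : realDomainType} (a b : R) k :
  0 <= b <= a -> k.+1%:R * b ^+ k * (a - b) <= a ^+ k.+1.
Proof.
move=> /andP[b0 ba]; suff : b ^+ k.+1 + k.+1%:R * b ^+ k * (a - b) <= a ^+ k.+1.
  by apply: le_trans; rewrite lerDr exprn_ge0.
elim: k => [|k IH]; first by rewrite !expr1 expr0 !mul1r addrC subrK.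
rewrite [a ^+ _]exprS; apply: le_trans (ler_wpM2l (le_trans b0 ba) IH).
rewrite -subr_ge0 [in X in _ <= X - _]exprS -[k.+2]addn1 natrD.
have -> : a * (b * b ^+ k + k.+1%:R * b ^+ k * (a - b)) -
    (b ^+ (k.+1 + 1) + (k.+1%:R + 1) * b ^+ k.+1 * (a - b)) =
    k.+1%:R * b ^+ k * (a - b) ^+ 2.
  by rewrite addn1 !exprS; ring.
by rewrite !mulr_ge0 ?exprn_ge0 ?subr_ge0.
Qed.

Lemma bounded_multiples {R : realType} (e C : R) k0 :
  0 < e -> ~ (forall k, (k0 <= k)%N -> k%:R * e <= C).
Proof.
move=> e0 h; pose k := maxn k0 (Num.Def.archi_bound (C / e)).
have C0 : 0 <= C by apply: le_trans (h k0 (leqnn _)); rewrite mulr_ge0 // ltW.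
have := h k (leq_maxl _ _); rewrite -ler_pdivlMr // leNgt => /negP; apply.
have := archi_boundP (divr_ge0 C0 (ltW e0)); move=> /lt_le_trans; apply.
by rewrite ler_nat leq_maxr.
Qed.

Lemma geometric_domination {R : realType} (a b e C : R) k0 :
  0 <= a -> 0 <= b -> 0 < e ->
  (forall k, (k0 <= k)%N -> a ^+ k * e <= C * b ^+ k) -> a <= b.
Proof.
move=> a0 b0 e0 h; rewrite leNgt; apply/negP => ba.
have [b00|bN0] := eqVneq b 0.
  have := h k0.+1 (leqnSn _); rewrite b00 expr0n mulr0 leNgt.
  by rewrite mulr_gt0 // exprn_gt0 // -b00.
have bp : 0 < b by rewrite lt_def bN0.
apply: (@bounded_multiples _ (e * (a - b)) (C * b) k0.+1).
  by rewrite mulr_gt0 // subr_gt0.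
case=> // k k0k; have hk := h k.+1 (ltnW k0k).
have bk : 0 < b ^+ k by rewrite exprn_gt0.
rewrite -(ler_pM2r bk).
have -> : C * b * b ^+ k = C * b ^+ k.+1 by rewrite exprS; ring.
apply: le_trans hk.
have := @ler_pow_bernoulli _ a b k; rewrite b0 ltW // => /(_ isT).
rewrite -(ler_pM2r e0); apply: le_trans.
by rewrite le_eqVlt; apply/orP; left; apply/eqP; ring.
Qed.

Section EntryNorm.
Context {R : realType}.

(** This norm bounds [opnorm] from above, and each entry is bounded by [opnorm],
    so both norms define the same convergence rates; the entries are easier to
    estimate. *)
Definition entry_norm {m n} (A : 'M[R[i]]_(m, n)) : R :=
  \sum_i \sum_j modulus (A i j).

Lemma entry_norm_ge0 m n (A : 'M[R[i]]_(m, n)) : 0 <= entry_norm A.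
Proof. by do 2![apply: sumr_ge0 => ? _]; exact: modulus_ge0. Qed.

Lemma entry_norm0 m n : entry_norm (0 : 'M[R[i]]_(m, n)) = 0.
Proof. by do 2![apply: big1 => ? _]; rewrite mxE modulus0. Qed.

Lemma entry_normD m n (A B : 'M[R[i]]_(m, n)) :
  entry_norm (A + B) <= entry_norm A + entry_norm B.
Proof.
rewrite -big_split; apply: ler_sum => i _; rewrite -big_split.
by apply: ler_sum => j _; rewrite mxE modulusD.
Qed.

Lemma entry_normZ m n z (A : 'M[R[i]]_(m, n)) :
  entry_norm (z *: A) = modulus z * entry_norm A.
Proof.
rewrite mulr_sumr; apply: eq_bigr => i _; rewrite mulr_sumr.
by apply: eq_bigr => j _; rewrite mxE modulusM.
Qed.

Lemma l2normC_le_sum n (x : 'cV[R[i]]_n) : l2normC x <= \sum_i modulus (x i 0).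
Proof.
have s0 : 0 <= \sum_i modulus (x i 0).
  by apply: sumr_ge0 => i _; exact: modulus_ge0.
rewrite -[X in _ <= X]ger0_norm // -sqrtr_sqr ler_wsqrtr // expr2 mulr_suml.
apply: ler_sum => i _; rewrite expr2 ler_wpM2l ?modulus_ge0 //.
rewrite (bigD1 i) //= lerDl.
by apply: sumr_ge0 => j _; exact: modulus_ge0.
Qed.

Lemma modulus_le_l2normC n (x : 'cV[R[i]]_n) i : modulus (x i 0) <= l2normC x.
Proof.
rewrite -[X in X <= _]ger0_norm ?modulus_ge0 // -sqrtr_sqr ler_wsqrtr //.
by rewrite (bigD1 i) //= lerDl; apply: sumr_ge0 => j _; exact: sqr_ge0.
Qed.

Lemma l2normC_mulmx_le n (A : 'M[R[i]]_n) (x : 'cV[R[i]]_n) :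
  l2normC x <= 1 -> l2normC (A *m x) <= entry_norm A.
Proof.
move=> x1; apply: le_trans (l2normC_le_sum _) _; apply: ler_sum => i _.
rewrite mxE; apply: le_trans (modulus_sum _ _) _; apply: ler_sum => j _.
rewrite modulusM -[X in _ <= X]mulr1 ler_wpM2l ?modulus_ge0 //.
exact: le_trans (modulus_le_l2normC _ _) x1.
Qed.

Lemma opnorm_le_entry_norm n (A : 'M[R[i]]_n) : opnorm A <= entry_norm A.
Proof.
apply: ge_sup => [|_ [x x1 <-]]; last exact: l2normC_mulmx_le.
exists (l2normC (A *m 0)); exists 0 => //=; rewrite /l2normC big1 ?sqrtr0 //.
by move=> i _; rewrite mxE modulus0 expr0n.
Qed.

Lemma modulus_entry_le_opnorm n (A : 'M[R[i]]_n) i j :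
  modulus (A i j) <= opnorm A.
Proof.
have -> : A i j = (A *m (delta_mx j 0 : 'cV__)) i 0 by rewrite -colE mxE.
apply: le_trans (modulus_le_l2normC _ _) _; apply: ub_le_sup.
  by exists (entry_norm A) => _ [x x1 <-]; exact: l2normC_mulmx_le.
exists (delta_mx j 0) => //=; rewrite /l2normC (bigD1 j) //= big1.
  by rewrite mxE !eqxx modulus1 expr1n addr0 sqrtr1.
by move=> k kj; rewrite mxE (negbTE kj) modulus0 expr0n.
Qed.

End EntryNorm.

Section Rates.
Context {R : realType} {n : nat}.
Implicit Types (A T Ainf : 'M[R[i]]_n) (mu : R).

Definition decays {p} (X : nat -> 'M[R[i]]_(n, p)) mu :=
  exists2 M : R, 0 <= M & forall k, entry_norm (X k) <= M * mu ^+ k.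

Lemma decays_eq p (X Y : nat -> 'M[R[i]]_(n, p)) mu :
  X =1 Y -> decays X mu -> decays Y mu.
Proof. by move=> XY [M M0 h]; exists M => // k; rewrite -XY. Qed.

Lemma decaysD p (X Y : nat -> 'M[R[i]]_(n, p)) mu :
  decays X mu -> decays Y mu -> decays (fun k => X k + Y k) mu.
Proof.
move=> [M M0 hM] [N N0 hN]; exists (M + N) => [|k]; first exact: addr_ge0.
by rewrite mulrDl; apply: le_trans (entry_normD _ _) _; rewrite lerD.
Qed.

Lemma decays_sum p (I : eqType) (r : seq I) (X : I -> nat -> 'M[R[i]]_(n, p)) mu :
  (forall i, i \in r -> decays (X i) mu) ->
  decays (fun k => \sum_(i <- r) X i k) mu.
Proof.
elim: r => [_|i r IH h].
  by exists 0 => // k; rewrite big_nil entry_norm0 mul0r.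
apply: (@decays_eq _ (fun k => X i k + \sum_(j <- r) X j k)).
  by move=> k; rewrite big_cons.
apply: decaysD; first by apply: h; rewrite mem_head.
by apply: IH => j jr; apply: h; rewrite inE jr orbT.
Qed.

Lemma linearly_convergent_decays A Ainf mu :
  0 <= mu < 1 -> decays (fun k => A ^+ k - Ainf) mu ->
  linearly_convergent A Ainf mu.
Proof.
move=> mu01 [M M0 h]; split=> //; exists 1%N, (M + 1).
split=> // [|k _]; first by rewrite ltr_wpDl.
have /andP[mu0 _] := mu01.
apply: le_trans (opnorm_le_entry_norm _) _; apply: le_trans (h k) _.
by rewrite ler_wpM2r ?exprn_ge0 // lerDl.
Qed.

Lemma mulmx_expr_eigen p T (B : 'M[R[i]]_(n, p)) (l : R[i]) k :
  T *m B = l *: B -> T ^+ k *m B = l ^+ k *: B.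
Proof.
move=> TB; elim: k => [|k IH]; first by rewrite !expr0 mul1mx scale1r.
by rewrite !exprSr -[T ^+ k * T]/(_ *m _) -mulmxA TB -scalemxAr IH scalerA mulrC.
Qed.

Lemma decays_eigen p T (B : 'M[R[i]]_(n, p)) (l : R[i]) mu :
  T *m B = l *: B -> modulus l <= mu -> decays (fun k => T ^+ k *m B) mu.
Proof.
move=> TB lmu; exists (entry_norm B) => [|k]; first exact: entry_norm_ge0.
rewrite (mulmx_expr_eigen k TB) entry_normZ mulrC modulusX.
by rewrite ler_wpM2l ?entry_norm_ge0 // lerXn2r ?nnegrE ?modulus_ge0 //
  (le_trans (modulus_ge0 _) lmu).
Qed.

(** [X] is the sum of an eigenmatrix for [l1], proportional to [Y], and of one
    for [l2]. *)
Lemma decays_simple_roots p T (X Y : 'M[R[i]]_(n, p)) (l1 l2 : R[i]) mu :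
  T *m X = l2 *: X + Y -> T *m Y = l1 *: Y -> l1 != l2 ->
  modulus l1 <= mu -> modulus l2 <= mu -> decays (fun k => T ^+ k *m X) mu.
Proof.
move=> TX TY l12 l1mu l2mu; pose B := (l1 - l2)^-1 *: Y.
have TB : T *m B = l1 *: B by rewrite -scalemxAr TY scalerA mulrC -scalerA.
have YB : Y = (l1 - l2) *: B by rewrite scalerA divff ?scale1r // subr_eq0.
have TC : T *m (X - B) = l2 *: (X - B).
  rewrite mulmxBr TX TB [in LHS]YB scalerBl [RHS]scalerBr -addrA.
  by congr (_ + _); rewrite addrAC subrr add0r.
apply: (@decays_eq _ (fun k => T ^+ k *m B + T ^+ k *m (X - B))).
  by move=> k; rewrite -mulmxDr addrC subrK.
by apply: decaysD; [apply: decays_eigen TB _ | apply: decays_eigen TC _].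
Qed.

(** This covers equal roots, where T^k X contains a term k l^(k-1) Y; any rate
    strictly above the moduli absorbs the factor k. *)
Lemma decays_roots_lt p T (X Y : 'M[R[i]]_(n, p)) (l1 l2 : R[i]) mu :
  T *m X = l2 *: X + Y -> T *m Y = l1 *: Y ->
  modulus l1 < mu -> modulus l2 < mu -> decays (fun k => T ^+ k *m X) mu.
Proof.
move=> TX TY l1mu l2mu; pose mu0 := Num.max (modulus l1) (modulus l2).
have mu0mu : mu0 < mu by rewrite gt_max l1mu.
have mu00 : 0 <= mu0 by rewrite le_max modulus_ge0.
(* Chosen so that |X| <= M and mu0 M + |Y| <= mu M, which are the base and the
   step of the induction on k. *)
pose M := entry_norm X + entry_norm Y / (mu - mu0).
have hY : entry_norm Y <= M * (mu - mu0).
  rewrite mulrDl divfK ?subr_eq0 ?gt_eqF // lerDr.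
  by rewrite mulr_ge0 ?entry_norm_ge0 // subr_ge0 ltW.
have M0 : 0 <= M.
  rewrite addr_ge0 ?entry_norm_ge0 // divr_ge0 ?entry_norm_ge0 //.
  by rewrite subr_ge0 ltW.
exists M => //; elim=> [|k IH].
  rewrite !expr0 mul1mx mulr1 lerDl divr_ge0 ?entry_norm_ge0 //.
  by rewrite subr_ge0 ltW.
rewrite exprSr -[T ^+ k * T]/(_ *m _) -mulmxA TX mulmxDr -scalemxAr.
rewrite (mulmx_expr_eigen k TY); apply: le_trans (entry_normD _ _) _.
rewrite !entry_normZ modulusX.
have h1 : modulus l2 * entry_norm (T ^+ k *m X) <= mu0 * (M * mu ^+ k).
  by apply: ler_pM; rewrite ?modulus_ge0 ?entry_norm_ge0 // le_max lexx orbT.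
have h2 : modulus l1 ^+ k * entry_norm Y <= mu ^+ k * (M * (mu - mu0)).
  apply: ler_pM; rewrite ?exprn_ge0 ?modulus_ge0 ?entry_norm_ge0 //.
  by rewrite lerXn2r ?nnegrE ?modulus_ge0 ?(ltW l1mu) // (le_trans mu00) // ltW.
apply: le_trans (lerD h1 h2) _; rewrite exprS le_eqVlt; apply/orP; left.
by apply/eqP; ring.
Qed.

(** Differences of consecutive powers eliminate the unknown limit. *)
Lemma rate_bounds_steps A Ainf mu (x : 'cV[R[i]]_n) :
  linearly_convergent A Ainf mu ->
  exists (k0 : nat) (C : R), forall k i, (k0 <= k)%N ->
    modulus ((A ^+ k *m (A *m x - x)) i 0) <= C * mu ^+ k.
Proof.
move=> [/andP[mu0 mu1] [k0 [M [_ M0 h]]]].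
exists k0, (2 * M * \sum_j modulus (x j 0)) => k i k0k.
have -> : A ^+ k *m (A *m x - x) =
    (A ^+ k.+1 - Ainf) *m x - (A ^+ k - Ainf) *m x.
  rewrite -mulmxBl opprB addrA subrK exprSr mulmxBl mulmxBr.
  by rewrite -[A ^+ k * A]/(_ *m _) mulmxA.
have bnd l : (k <= l)%N ->
    modulus (((A ^+ l - Ainf) *m x) i 0) <= M * mu ^+ k * \sum_j modulus (x j 0).
  move=> kl; rewrite mxE; apply: le_trans (modulus_sum _ _) _.
  rewrite mulr_sumr; apply: ler_sum => j _; rewrite modulusM.
  rewrite ler_wpM2r ?modulus_ge0 //.
  apply: le_trans (modulus_entry_le_opnorm _ _ _) _.
  apply: le_trans (h l (leq_trans k0k kl)) _.
  by rewrite ler_wpM2l ?(ltW M0) // ler_wiXn2l // ltW.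
rewrite mxE [(- _ : 'cV__) _ _]mxE; apply: le_trans (modulusD _ _) _.
rewrite modulusN; apply: le_trans (lerD (bnd k.+1 (leqnSn k)) (bnd k (leqnn k))) _.
by rewrite le_eqVlt; apply/orP; left; apply/eqP; ring.
Qed.

(** On an eigenvector the differences of consecutive powers are
    l^k (l - 1) x, and l - 1 is not zero. *)
Lemma rate_ge_modulus A Ainf mu (l : R[i]) (x : 'cV[R[i]]_n) :
  linearly_convergent A Ainf mu -> A *m x = l *: x -> x != 0 -> l != 1 ->
  modulus l <= mu.
Proof.
move=> cvgA Ax x0 l1; have [k0 [C hC]] := rate_bounds_steps x cvgA.
have [/andP[mu0 _] _] := cvgA.
have [i xi] : exists i, x i 0 != 0.
  apply/existsP; rewrite -negb_forall; apply: contra x0 => /forallP x0.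
  by apply/eqP/colP => i; rewrite mxE; apply/eqP/x0.
apply: (@geometric_domination _ _ _ (modulus (l - 1) * modulus (x i 0)) C k0).
- exact: modulus_ge0.
- exact: mu0.
- rewrite mulr_gt0 // lt_def modulus_ge0 andbT.
    by apply: contra l1 => /eqP/modulus_eq0/eqP; rewrite subr_eq0.
  by apply: contra xi => /eqP/modulus_eq0/eqP.
move=> k k0k; have := hC k i k0k.
rewrite Ax -[X in _ - X]scale1r -scalerBl -scalemxAr (mulmx_expr_eigen k Ax).
by rewrite !mxE !modulusM modulusX mulrCA.
Qed.

Lemma mulmx_expr_jordan T (v z : 'cV[R[i]]_n) (l : R[i]) k :
  T *m v = l *: v + z -> T *m z = l *: z ->
  T ^+ k.+1 *m v = l ^+ k.+1 *: v + (k.+1%:R * l ^+ k) *: z.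
Proof.
move=> Tv Tz; elim: k => [|k IH]; first by rewrite !expr1 expr0 mulr1 scale1r.
rewrite exprS -[T * _]/(_ *m _) -mulmxA IH mulmxDr -!scalemxAr Tv Tz.
rewrite scalerDr !scalerA -addrA -scalerDl -exprSr; congr (_ + _ *: z).
by rewrite -[k.+2]addn1 natrD exprSr; ring.
Qed.

(** On a generalized eigenvector the differences of consecutive powers contain
    the term k l^(k-1) (l - 1) z, while the rest is of the order of l^k. *)
Lemma jordan_modulus_not_rate A Ainf (v z : 'cV[R[i]]_n) (l : R[i]) :
  A *m v = l *: v + z -> A *m z = l *: z -> z != 0 -> l != 0 -> l != 1 ->
  ~ linearly_convergent A Ainf (modulus l).
Proof.
move=> Av Az z0 l0 l1 cvgA; have [k0 [C hC]] := rate_bounds_steps v cvgA.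
have [i zi] : exists i, z i 0 != 0.
  apply/existsP; rewrite -negb_forall; apply: contra z0 => /forallP z0.
  by apply/eqP/colP => i; rewrite mxE; apply/eqP/z0.
have ml : 0 < modulus l.
  by rewrite lt_def modulus_ge0 andbT; apply: contra l0 => /eqP/modulus_eq0/eqP.
(* [D] collects, up to the factor l^k, the terms without the factor k. *)
pose D := modulus ((l - 1) * l * v i 0) + modulus (l * z i 0).
apply: (@bounded_multiples _ (modulus ((l - 1) * z i 0))
   (C * modulus l + D) k0.+1).
  rewrite modulusM mulr_gt0 // lt_def modulus_ge0 andbT.
    by apply: contra l1 => /eqP/modulus_eq0/eqP; rewrite subr_eq0.
  by apply: contra zi => /eqP/modulus_eq0/eqP.
case=> // k k0k; have := hC k.+1 i (ltnW k0k).
have -> : A *m v - v = (l - 1) *: v + z.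
  by rewrite Av scalerBl scale1r addrAC.
rewrite mulmxDr -scalemxAr (mulmx_expr_jordan _ Av Az) (mulmx_expr_eigen _ Az).
rewrite !mxE => h.
have lk : 0 < modulus l ^+ k by rewrite exprn_gt0.
rewrite -(ler_pM2l lk).
have -> : modulus l ^+ k * (k.+1%:R * modulus ((l - 1) * z i 0)) =
   modulus (k.+1%:R * l ^+ k * ((l - 1) * z i 0)).
  rewrite [RHS]modulusM [in RHS]modulusM modulusX.
  have -> : modulus (k.+1%:R : R[i]) = k.+1%:R.
    by rewrite -[X in modulus X](rmorph_nat (real_complex R)) modulus_real ger0_norm.
  by ring.
have -> : k.+1%:R * l ^+ k * ((l - 1) * z i 0) =
    ((l - 1) * (l ^+ k.+1 * v i 0 + k.+1%:R * l ^+ k * z i 0) + l ^+ k.+1 * z i 0)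
    - (l ^+ k * ((l - 1) * l * v i 0) + l ^+ k * (l * z i 0)).
  by rewrite exprS; ring.
apply: le_trans (modulusD _ _) _; rewrite modulusN [X in _ <= X]mulrDr.
apply: lerD; first by rewrite mulrCA -exprSr.
by apply: le_trans (modulusD _ _) _; rewrite !(modulusM (l ^+ k)) modulusX -mulrDr.
Qed.

End Rates.

(** * The algebra of two orthogonal projectors *)

Section RealMatrices.
Context {R : realType} {n : nat}.
Implicit Types (A : 'M[R]_n) (x y z : 'cV[R]_n).

Lemma dotvNl x y : dotv (- x) y = - dotv x y.
Proof. by rewrite -scaleN1r dotvZl mulN1r. Qed.

Lemma dotvDr x y z : dotv x (y + z) = dotv x y + dotv x z.
Proof. by rewrite dotvC dotvDl ![dotv _ x]dotvC. Qed.

Lemma dotvZr (a : R) x y : dotv x (a *: y) = a * dotv x y.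
Proof. by rewrite dotvC dotvZl dotvC. Qed.

Lemma dotv_mulmxl A x y : dotv (A *m x) y = dotv x (A^T *m y).
Proof. by rewrite !dotvE trmx_mul mulmxA. Qed.

Lemma mulmx_col p (A : 'M[R]_n) (B : 'M[R]_(n, p)) j :
  A *m col j B = col j (A *m B).
Proof. by rewrite !colE mulmxA. Qed.

(** For a symmetric [A], the vector A x has squared norm <x, A A x>. *)
Lemma symmetric_sqr_ker p A (X : 'M[R]_(n, p)) :
  A^T = A -> A *m A *m X = 0 -> A *m X = 0.
Proof.
move=> Asym AAX; apply/matrixP => i j; rewrite [RHS]mxE.
have : A *m col j X = 0.
  apply: dotvv_eq0; rewrite dotv_mulmxl Asym !mulmx_col mulmxA AAX col0.
  by rewrite dotvE mulmx0 mxE.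
by rewrite mulmx_col => /matrixP/(_ i 0); rewrite !mxE.
Qed.

End RealMatrices.

Section Projectors.
Context {R : realType} {n : nat}.
Implicit Types (W : {vspace 'cV[R]_n}) (x y : 'cV[R]_n).

Lemma projmx_memP W x :
  projmx W *m x \in W /\ x - projmx W *m x \in orthoc W.
Proof.
rewrite projmxE; have [p pW xp] := proj_vspace_exists W x.
by rewrite (proj_vspaceP pW xp).
Qed.

Lemma projmx_id W x : x \in W -> projmx W *m x = x.
Proof.
by move=> xW; rewrite projmxE; apply: proj_vspaceP; rewrite // subrr mem0v.
Qed.

Lemma projmx_idem W : projmx W *m projmx W = projmx W.
Proof.
apply: mulmx_cV_inj => x; rewrite -mulmxA projmx_id //.
by have [] := projmx_memP W x.
Qed.

Lemma projmx_fixE W x : (x \in W) = (projmx W *m x == x).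
Proof.
apply/idP/eqP => [|<-]; first exact: projmx_id.
by have [] := projmx_memP W x.
Qed.

Lemma projmx_orthoc W x : x \in orthoc W <-> projmx W *m x = 0.
Proof.
split=> [xW|Px]; last by have [_] := projmx_memP W x; rewrite Px subr0.
by rewrite projmxE; apply: proj_vspaceP; rewrite ?mem0v // subr0.
Qed.

(** A projection differs from its argument by a vector orthogonal to the space,
    so <P x, y> = <P x, P y> is symmetric in x and y. *)
Lemma projmx_sym W : (projmx W)^T = projmx W.
Proof.
have h x y : dotv (projmx W *m x) y = dotv (projmx W *m x) (projmx W *m y).
  have [_ /memv_orthoc h] := projmx_memP W y.
  have := h _ (projmx_memP W x).1; rewrite dotvC dotvDl dotvNl.
  by move/eqP; rewrite subr_eq0 dotvC [X in _ == X]dotvC => /eqP.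
apply: mulmx_cV_inj => y; apply/colP => i.
have dE (z : 'cV[R]_n) : z i 0 = dotv (delta_mx i 0) z.
  rewrite /dotv (bigD1 i) //= big1 => [|j ji].
    by rewrite mxE !eqxx mul1r addr0.
  by rewrite mxE (negbTE ji) mul0r.
by rewrite !dE -dotv_mulmxl h dotvC -h dotvC.
Qed.

End Projectors.

Section TwoProjectors.
Context {R : realType} {n : nat}.
Variables P Q : 'M[R]_n.
Hypotheses (Psym : P^T = P) (Qsym : Q^T = Q).
Hypotheses (PP : P *m P = P) (QQ : Q *m Q = Q).

(** On a plane spanned by a line of the range of [P] and a line of the range of
    [Q] at angle t, [pdiff] and [pcosum] are sin t and cos t times two
    anticommuting reflections, and [psin2] is the scalar sin(t)^2.  The matrix
    [pturn beta] is, up to a factor and an additive scalar on each such plane,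
    the AAMR operator. *)
Definition pdiff : 'M[R]_n := P - Q.
Definition pcosum : 'M[R]_n := 1%:M - P - Q.
Definition psin2 : 'M[R]_n := pdiff *m pdiff.
Definition pturn (b : R) : 'M[R]_n := (b *: pdiff + (1 - b)%:M) *m pcosum.

Local Notation D := pdiff.
Local Notation J := pcosum.
Local Notation S := psin2.
Local Notation N := pturn.

Lemma pdiff_sym : D^T = D.
Proof. by rewrite /D linearB /= Psym Qsym. Qed.

Lemma pcosum_sym : J^T = J.
Proof. by rewrite /J !linearB /= Psym Qsym tr_scalar_mx. Qed.

Lemma psin2_sym : S^T = S.
Proof. by rewrite /S trmx_mul pdiff_sym. Qed.

Lemma pdiff_pcosum : D *m J = Q *m P - P *m Q.
Proof.
rewrite /D /J !mulmxBl !mulmxBr !mulmx1 PP QQ.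
move: (P *m Q) (Q *m P) => X Y; apply/matrixP => i j; rewrite !mxE; ring.
Qed.

Lemma pcosum_pdiff : J *m D = - (D *m J).
Proof.
rewrite pdiff_pcosum /D /J !mulmxBl !mulmxBr !mul1mx PP QQ.
move: (P *m Q) (Q *m P) => X Y; apply/matrixP => i j; rewrite !mxE; ring.
Qed.

Lemma psin2E : S = P + Q - P *m Q - Q *m P.
Proof.
rewrite /S /D !mulmxBl !mulmxBr PP QQ.
move: (P *m Q) (Q *m P) => X Y; apply/matrixP => i j; rewrite !mxE; ring.
Qed.

Lemma pcosum_sqr : J *m J = 1%:M - S.
Proof.
rewrite psin2E /J !mulmxBl !mulmxBr !mul1mx !mulmx1 PP QQ.
move: (P *m Q) (Q *m P) => X Y; apply/matrixP => i j; rewrite !mxE; ring.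
Qed.

Lemma psin2_comm_diff : S *m D = D *m S.
Proof. by rewrite /S mulmxA. Qed.

Lemma psin2_comm_cosum : S *m J = J *m S.
Proof.
have -> : S = 1%:M - J *m J by rewrite pcosum_sqr opprB addrC subrK.
by rewrite [LHS]mulmxBl [RHS]mulmxBr mul1mx mulmx1 mulmxA.
Qed.

Lemma psin2_comm_P : S *m P = P *m S.
Proof.
rewrite psin2E !(mulmxBl, mulmxDl) !(mulmxBr, mulmxDr) !mulmxA PP -(mulmxA Q) PP.
move: (P *m Q *m P) (P *m Q) (Q *m P) => Z X Y.
by apply/matrixP => i j; rewrite !mxE; ring.
Qed.

Lemma psin2_comm_Q : S *m Q = Q *m S.
Proof.
rewrite psin2E !(mulmxBl, mulmxDl) !(mulmxBr, mulmxDr) !mulmxA QQ -(mulmxA P) QQ.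
move: (Q *m P *m Q) (P *m Q) (Q *m P) => Z X Y.
by apply/matrixP => i j; rewrite !mxE; ring.
Qed.

Lemma psin2_comm_turn b : S *m N b = N b *m S.
Proof.
have h : S *m (b *: D + (1 - b)%:M) = (b *: D + (1 - b)%:M) *m S.
  rewrite (mulmxDr S) (mulmxDl _ _ S) -scalemxAr -scalemxAl psin2_comm_diff.
  by rewrite scalar_mxC.
by rewrite /N mulmxA h -(mulmxA _ S) -(mulmxA _ J S) psin2_comm_cosum.
Qed.

(** Moving the inner factor J across D changes the sign of D, so the product is
    ((1 - b) + b D) ((1 - b) - b D) J^2. *)
Lemma pturn_sqr b : N b *m N b =
  ((1 - b) ^+ 2)%:M *m (1%:M - S) - b ^+ 2 *: (S *m (1%:M - S)).
Proof.
have anti : J *m (b *: D + (1 - b)%:M) = (- (b *: D) + (1 - b)%:M) *m J.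
  rewrite (mulmxDr J) (mulmxDl _ _ J) -scalemxAr pcosum_pdiff scalerN.
  by rewrite mulNmx scalemxAl scalar_mxC.
rewrite /N mulmxA -(mulmxA _ J) anti mulmxA -mulmxA pcosum_sqr scalemxAl.
rewrite -mulmxBl; congr (_ *m _); rewrite -/S /S.
move: D => X; rewrite mulmxDl !mulmxDr !mulmxN -!scalemxAl -!scalemxAr.
rewrite mul_mx_scalar !mul_scalar_mx scale_scalar_mx !scalerA -!expr2.
by rewrite addrA addrK addrC.
Qed.

Section Eigen.
Context {p : nat} {s : R} {X : 'M[R]_(n, p)}.
Hypothesis SX : S *m X = s *: X.

Lemma psin2_eigen_comm A : S *m A = A *m S -> S *m (A *m X) = s *: (A *m X).
Proof. by move=> SA; rewrite mulmxA SA -mulmxA SX -scalemxAr. Qed.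

Lemma pcosum_sqr_eigen : J *m (J *m X) = (1 - s) *: X.
Proof.
by rewrite mulmxA pcosum_sqr (mulmxBl _ S) mul1mx SX scalerBl scale1r.
Qed.

Lemma pturn_sqr_eigen b :
  N b *m (N b *m X) = ((1 - s) * ((1 - b) ^+ 2 - b ^+ 2 * s)) *: X.
Proof.
rewrite mulmxA pturn_sqr.
have CX : (1%:M - S) *m X = (1 - s) *: X.
  by rewrite (mulmxBl _ S) mul1mx SX scalerBl scale1r.
rewrite (mulmxBl _ (b ^+ 2 *: _)) -mulmxA CX mul_scalar_mx -scalemxAl -mulmxA CX.
by rewrite -scalemxAr SX !scalerA -scalerBl; congr (_ *: _); ring.
Qed.

End Eigen.

Section EigenVector.
Context {s : R} {x : 'cV[R]_n}.
Hypotheses (Sx : S *m x = s *: x) (x0 : x != 0).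

Let xx0 : 0 < dotv x x.
Proof.
by rewrite lt_def dotvv_ge0 andbT; apply: contra x0 => /eqP/dotvv_eq0 ->.
Qed.

(** s |x|^2 = |D x|^2. *)
Lemma psin2_eigen_ge0 : 0 <= s.
Proof.
have : 0 <= dotv (D *m x) (D *m x) by exact: dotvv_ge0.
rewrite dotv_mulmxl pdiff_sym mulmxA Sx dotvC dotvZl.
by rewrite pmulr_lge0.
Qed.

(** (1 - s) |x|^2 = |J x|^2. *)
Lemma psin2_eigen_le1 : s <= 1.
Proof.
have : 0 <= dotv (J *m x) (J *m x) by exact: dotvv_ge0.
rewrite dotv_mulmxl pcosum_sym (pcosum_sqr_eigen Sx) dotvC dotvZl.
by rewrite pmulr_lge0 // subr_ge0.
Qed.

(** Suppose that N is the scalar [w] on the eigenspace.  As N D = - D N and D is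
    injective there for s > 0, w = 0.  As J is invertible there for s < 1, the
    factor beta D + (1 - beta) then vanishes, so D is a nonzero scalar; this
    contradicts that D anticommutes with J. *)
Lemma pturn_not_scalar (b w : R) : 0 < s < 1 -> 0 < b < 1 ->
  exists2 y : 'cV[R]_n, S *m y = s *: y & N b *m y != w *: y.
Proof.
move=> /andP[s0 s1] /andP[b0 b1]; apply/not_exists2P => h.
have {}h (y : 'cV[R]_n) : S *m y = s *: y -> N b *m y = w *: y.
  by move=> Sy; have [//|/negP/negPn/eqP] := h y.
have Dinj (y : 'cV[R]_n) : S *m y = s *: y -> D *m y = 0 -> y = 0.
  move=> Sy Dy; apply/eqP; move: Sy; rewrite /S -mulmxA Dy mulmx0 => /esym/eqP.
  by rewrite scaler_eq0 gt_eqF.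
have Jinj (y : 'cV[R]_n) : S *m y = s *: y -> J *m y = 0 -> y = 0.
  move=> Sy Jy; apply/eqP; have := pcosum_sqr_eigen Sy.
  rewrite Jy mulmx0 => /esym/eqP.
  by rewrite scaler_eq0 subr_eq0 gt_eqF.
have NE (y : 'cV[R]_n) : N b *m y = b *: (D *m (J *m y)) + (1 - b) *: (J *m y).
  by rewrite /N -mulmxA mulmxDl -scalemxAl mul_scalar_mx.
have SJ (y : 'cV[R]_n) : S *m y = s *: y -> S *m (J *m y) = s *: (J *m y).
  by move=> Sy; apply: psin2_eigen_comm => //; exact: psin2_comm_cosum.
have SD (y : 'cV[R]_n) : S *m y = s *: y -> S *m (D *m y) = s *: (D *m y).
  by move=> Sy; apply: psin2_eigen_comm => //; exact: psin2_comm_diff.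
have JD (y : 'cV[R]_n) : J *m (D *m y) = - (D *m (J *m y)).
  by rewrite mulmxA pcosum_pdiff mulNmx mulmxA.
have w0 : w = 0.
  have := h _ (SD _ Sx).
  have -> : N b *m (D *m x) = - (D *m (N b *m x)).
    by rewrite !NE JD mulmxDr -!scalemxAr mulmxN !scalerN opprD.
  rewrite (h _ Sx) -scalemxAr => /eqP; rewrite -subr_eq0 -opprD oppr_eq0.
  rewrite -scalerDl scaler_eq0 => /orP[|/eqP/(Dinj _ Sx) xx].
    by rewrite -mulr2n mulrn_eq0 /= => /eqP.
  by have := x0; rewrite xx eqxx.
have DE (y : 'cV[R]_n) : S *m y = s *: y -> b *: (D *m y) = - ((1 - b) *: y).
  move=> Sy; have := h _ (SJ _ Sy); rewrite NE w0 scale0r.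
  rewrite (pcosum_sqr_eigen Sy) -scalemxAr !scalerA ![_ * (1 - s)]mulrC.
  rewrite -!scalerA -scalerDr => /eqP; rewrite scaler_eq0 subr_eq0 gt_eqF //=.
  by rewrite addr_eq0 => /eqP.
have : (1 - b) *: (J *m x) == 0.
  have h1 := DE _ (SJ _ Sx).
  have : b *: (J *m (D *m x)) = - ((1 - b) *: (J *m x)).
    by rewrite scalemxAr DE // mulmxN -scalemxAr.
  rewrite JD scalerN h1 opprK => /eqP; rewrite -addr_eq0 -mulr2n.
  by rewrite -scaler_nat scaler_eq0 pnatr_eq0.
rewrite scaler_eq0 subr_eq0 gt_eqF //= => /eqP/(Jinj _ Sx) xx.
by have := x0; rewrite xx eqxx.
Qed.

(** If P kills x and Q x, then S x = Q x, so that Q has the eigenvalue s, which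
    is impossible for a projector. *)
Lemma psin2_eigen_range : 0 < s < 1 ->
  exists2 y : 'cV[R]_n, S *m y = s *: y & P *m y = y /\ y != 0.
Proof.
move=> /andP[s0 s1].
have [Px0|Px0] := eqVneq (P *m x) 0; last first.
  exists (P *m x); last by rewrite mulmxA PP.
  by apply: psin2_eigen_comm => //; exact: psin2_comm_P.
have SQx : S *m (Q *m x) = s *: (Q *m x).
  by apply: psin2_eigen_comm => //; exact: psin2_comm_Q.
have SPQx : S *m (P *m (Q *m x)) = s *: (P *m (Q *m x)).
  by apply: psin2_eigen_comm => //; exact: psin2_comm_P.
exists (P *m (Q *m x)) => //; split; first by rewrite mulmxA PP.
apply: contra x0 => /eqP PQx.
have Qx : Q *m x = s *: x.
  rewrite -Sx psin2E !mulmxBl mulmxDl Px0 -!mulmxA PQx Px0 mulmx0.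
  by rewrite !subr0 add0r.
have : Q *m (Q *m x) = Q *m x by rewrite mulmxA QQ.
rewrite Qx -scalemxAr Qx => /eqP; rewrite -subr_eq0 scalerA -scalerBl.
rewrite scaler_eq0 => /orP[|//].
have -> : s * s - s = s * (s - 1) by ring.
by rewrite mulf_eq0 gt_eqF //= subr_eq0 lt_eqF.
Qed.

End EigenVector.

End TwoProjectors.

(** * The Friedrichs cosine as an eigenvalue *)

Section Friedrichs.
Context {R : realType} {n : nat}.
Variables U V : {vspace 'cV[R]_n}.
Implicit Types (x u v w : 'cV[R]_n).

Local Notation P := (projmx U).
Local Notation Q := (projmx V).
Local Notation S := (psin2 P Q).

(** The kernel of D^2 is the kernel of D = P - Q. *)
Lemma psin2_ker p (X : 'M[R]_(n, p)) : S *m X = 0 -> P *m X = Q *m X.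
Proof.
move=> SX; apply/eqP; rewrite -subr_eq0 -mulmxBl; apply/eqP.
by apply: symmetric_sqr_ker SX; rewrite linearB /= !projmx_sym.
Qed.

Lemma psin2_capv w : w \in (U :&: V)%VS -> S *m w = 0.
Proof.
rewrite memv_cap => /andP[/projmx_id wU /projmx_id wV].
have Dw : pdiff P Q *m w = 0 by rewrite mulmxBl wU wV subrr.
by rewrite /psin2 -mulmxA Dw mulmx0.
Qed.

Lemma psin2_eigen_orthoc s x :
  s != 0 -> S *m x = s *: x -> x \in orthoc (U :&: V).
Proof.
move=> s0 Sx; apply/memv_orthoc => w wUV; apply/eqP.
rewrite -(inj_eq (mulfI s0)) mulr0 dotvC -dotvZl -Sx dotv_mulmxl.
by rewrite psin2_sym ?projmx_sym // psin2_capv // dotvE mulmx0 mxE.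
Qed.

Lemma psin2_ker_orthoc u x :
  u \in (U :&: orthoc (U :&: V))%VS -> S *m x = 0 -> dotv u x = 0.
Proof.
rewrite memv_cap => /andP[/projmx_id uU /memv_orthoc uO] /psin2_ker PQx.
rewrite -uU dotv_mulmxl projmx_sym dotvC; apply: uO; rewrite memv_cap.
have [-> _] := projmx_memP U x.
by rewrite PQx; have [-> _] := projmx_memP V x.
Qed.

(** S u = u - P Q u for u in U. *)
Lemma projmx_norm_psin2 u :
  u \in U -> dotv (Q *m u) (Q *m u) = dotv u u - dotv u (S *m u).
Proof.
move=> /projmx_id uU.
have Su : S *m u = u - P *m (Q *m u).
  rewrite psin2E ?projmx_idem // !mulmxBl mulmxDl uU -!mulmxA uU.
  by rewrite addrAC addrK.
have PQu : dotv u (P *m (Q *m u)) = dotv u (Q *m u).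
  by rewrite -{1}[P]projmx_sym -dotv_mulmxl uU.
have Qu : dotv (Q *m u) (Q *m u) = dotv u (Q *m u).
  by rewrite dotv_mulmxl projmx_sym mulmxA projmx_idem.
rewrite Qu -PQu Su [dotv u (u - _)]dotvC dotvDl dotvNl.
by rewrite [dotv (P *m _) u]dotvC opprB addrC subrK.
Qed.

Lemma dotv_le_of_norms (a b : 'cV[R]_n) (k : R) :
  0 <= k -> dotv a a <= k ^+ 2 -> dotv b b <= 1 -> dotv a b <= k.
Proof.
move=> k0 ak b1; have [k00|kN0] := eqVneq k 0.
  have -> : a = 0.
    apply: dotvv_eq0; apply/eqP; rewrite eq_le dotvv_ge0 andbT.
    by apply: le_trans ak _; rewrite k00 expr0n.
  by rewrite dotvE trmx0 mul0mx mxE.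
have kp : 0 < k by rewrite lt_def kN0.
have := dotvv_ge0 (a + (- k) *: b).
rewrite dotvDl !dotvDr !dotvZl !dotvZr [dotv b a]dotvC => h.
rewrite -(ler_pM2l kp) -expr2.
have : k ^+ 2 * dotv b b <= k ^+ 2 * 1 by rewrite ler_wpM2l ?sqr_ge0.
by rewrite expr2 in ak *; lra.
Qed.

Lemma l2norm_le1 x : (l2norm x <= 1) = (dotv x x <= 1).
Proof. by rewrite /l2norm -{1}[1]sqrtr1 ler_sqrt. Qed.

(** Take a unit eigenvector u in U and the normalization of Q u. *)
Lemma friedrichs_cos_attained s x : 0 < s < 1 -> S *m x = s *: x -> x != 0 ->
  exists u v, [/\ u \in (U :&: orthoc (U :&: V))%VS,
    v \in (V :&: orthoc (U :&: V))%VS, l2norm u <= 1, l2norm v <= 1 &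
    Num.sqrt (1 - s) = dotv u v].
Proof.
move=> s01 Sx x0; have /andP[s0 s1] := s01.
have sN0 : s != 0 by rewrite gt_eqF.
have [y Sy [Py y0]] : exists2 y : 'cV_n, S *m y = s *: y & P *m y = y /\ y != 0.
  by apply: psin2_eigen_range Sx x0 s01; exact: projmx_idem.
have yU : y \in U by rewrite -Py; have [] := projmx_memP U y.
have SQy : S *m (Q *m y) = s *: (Q *m y).
  by apply: psin2_eigen_comm => //; apply: psin2_comm_Q; exact: projmx_idem.
have yy : 0 < dotv y y.
  by rewrite lt_def dotvv_ge0 andbT; apply: contra y0 => /eqP/dotvv_eq0 ->.
have QyQy : dotv (Q *m y) (Q *m y) = (1 - s) * dotv y y.
  by rewrite projmx_norm_psin2 // Sy dotvZr; ring.
set c := Num.sqrt (1 - s); set m := Num.sqrt (dotv y y).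
have c0 : 0 < c by rewrite sqrtr_gt0 subr_gt0.
have m0 : 0 < m by rewrite sqrtr_gt0.
have c2 : c ^+ 2 = 1 - s by rewrite sqr_sqrtr // subr_ge0 ltW.
have m2 : m ^+ 2 = dotv y y by rewrite sqr_sqrtr // ltW.
have cN0 : c != 0 by rewrite gt_eqF.
have mN0 : m != 0 by rewrite gt_eqF.
exists (m^-1 *: y), ((m^-1 * c^-1) *: (Q *m y)); split.
- by rewrite memvZ // memv_cap yU (psin2_eigen_orthoc sN0 Sy).
- rewrite memvZ // memv_cap (psin2_eigen_orthoc sN0 SQy) andbT.
  by have [] := projmx_memP V y.
- rewrite l2norm_le1 dotvZl dotvZr -m2.
  by rewrite le_eqVlt; apply/orP; left; apply/eqP; field.
- rewrite l2norm_le1 dotvZl dotvZr QyQy -c2 -m2.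
  by rewrite le_eqVlt; apply/orP; left; apply/eqP; field; rewrite cN0.
rewrite dotvZl dotvZr.
have -> : dotv y (Q *m y) = dotv (Q *m y) (Q *m y).
  by rewrite [RHS]dotv_mulmxl projmx_sym mulmxA projmx_idem.
by rewrite QyQy -c2 -m2; field; rewrite cN0.
Qed.

(** The eigenvalue 0 does not contribute to a vector u of U orthogonal to
    the intersection, so <u, S u> >= s |u|^2, and <u, v> = <Q u, v> is bounded
    through the norm of Q u.  The bound is reached at an eigenvector for s, or
    at u = v = 0 if s = 1. *)
Lemma friedrichs_cosE rs E s : spectral_resolution S rs E ->
  s \in rs -> 0 < s -> (forall r, r \in rs -> r != 0 -> s <= r) ->
  friedrichs_cos U V = Num.sqrt (1 - s).
Proof.
move=> res srs s0 smin; have [E1 hE] := res.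
have [x Sx x0] := resolution_eigenvector res srs.
have s1 : s <= 1.
  by apply: psin2_eigen_le1 Sx x0; rewrite ?projmx_sym ?projmx_idem.
rewrite /friedrichs_cos; set A := (X in sup X); have ubA : ubound A (Num.sqrt (1 - s)).
  move=> _ [u [v [uU vV u1 v1 ->]]].
  have uU' : u \in U by move: uU; rewrite memv_cap => /andP[].
  have vV' : v \in V by move: vV; rewrite memv_cap => /andP[].
  rewrite -(projmx_id vV') -{1}[Q]projmx_sym -dotv_mulmxl.
  apply: dotv_le_of_norms; rewrite ?sqrtr_ge0 -?l2norm_le1 //.
  rewrite sqr_sqrtr ?subr_ge0 // projmx_norm_psin2 //.
  have dsum (y : R -> 'cV[R]_n) : dotv u (\sum_(r <- rs) y r) = \sum_(r <- rs) dotv u (y r).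
    by rewrite dotvE mulmx_sumr summxE; apply: eq_bigr => r _; rewrite dotvE.
  have uE : u = \sum_(r <- rs) E r *m u by rewrite -mulmx_suml E1 mul1mx.
  have : s * dotv u u <= dotv u (S *m u).
    rewrite [X in S *m X]uE [X in s * dotv _ X]uE mulmx_sumr !dsum mulr_sumr.
    rewrite !big_seq; apply: ler_sum => r rrs; have [_ SEr Esym Eid] := hE r rrs.
    rewrite mulmxA SEr -scalemxAl dotvZr.
    have [r0|rN0] := eqVneq r 0.
      have -> : dotv u (E r *m u) = 0; last by rewrite !mulr0.
      by apply: psin2_ker_orthoc; rewrite // mulmxA SEr r0 scale0r mul0mx.
    rewrite ler_wpM2r ?smin // -Eid -mulmxA -{1}Esym -dotv_mulmxl.
    exact: dotvv_ge0.
  have : (1 - s) * dotv u u <= (1 - s) * 1.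
    by rewrite ler_wpM2l ?subr_ge0 // -l2norm_le1.
  lra.
apply/eqP; rewrite eq_le; apply/andP; split.
  apply: ge_sup => //; exists 0, 0, 0; split; rewrite ?mem0v //.
  - by rewrite l2norm_le1 dotvE mulmx0 mxE.
  - by rewrite l2norm_le1 dotvE mulmx0 mxE.
  - by rewrite dotvE mulmx0 mxE.
apply: ub_le_sup; first by exists (Num.sqrt (1 - s)).
move: s1; rewrite le_eqVlt => /predU1P[s1|s1].
  exists 0, 0; split; rewrite ?mem0v //.
  - by rewrite l2norm_le1 dotvE mulmx0 mxE.
  - by rewrite l2norm_le1 dotvE mulmx0 mxE.
  - by rewrite s1 subrr sqrtr0 dotvE mulmx0 mxE.
by apply: friedrichs_cos_attained Sx x0; rewrite s0.
Qed.

End Friedrichs.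

(** * The AAMR operator on one eigenspace *)

Section AAMRBlocks.
Context {R : realType} {n : nat}.
Variables (alpha beta : R) (U V : {vspace 'cV[R]_n}).
Hypotheses (halpha : 0 < alpha <= 1) (hbeta : 0 < beta < 1).

Local Notation P := (projmx U).
Local Notation Q := (projmx V).
Local Notation S := (psin2 P Q).
Local Notation N := (pturn P Q beta).
Local Notation T := (aamr alpha beta U V).
Local Notation Pinf := (projmx (orthoc U :&: orthoc V)%VS).
Local Notation mean := (block_mean alpha beta).
Local Notation disc := (block_disc beta).
Local Notation radius := (block_radius alpha beta).
Local Notation rho := (1 - 4 * alpha * beta * (1 - beta)).
Local Notation C := (map_mx (real_complex R)).

Lemma aamr_decomposition : T =
  (1 - 2 * alpha * beta)%:M + (2 * alpha * beta ^+ 2) *: (1%:M - S)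
  + (2 * alpha * beta) *: N.
Proof.
have -> : N = beta *: (Q *m P - P *m Q) + (1 - beta) *: pcosum P Q.
  by rewrite /pturn mulmxDl mul_scalar_mx -scalemxAl pdiff_pcosum ?projmx_idem.
rewrite psin2E ?projmx_idem // /aamr /pcosum mulmxBl !mulmxBr mul1mx !mulmx1.
rewrite -scalemxAl -scalemxAr.
rewrite -[(1 - alpha)%:M]scalemx1 -[(1 - 2 * alpha * beta)%:M]scalemx1.
move: (1%:M) (P *m Q) (Q *m P) => I X Y.
by apply/matrixP => i j; rewrite !mxE; ring.
Qed.

Lemma aamr_eigen p (X : 'M[R]_(n, p)) s c : S *m X = s *: X -> c ^+ 2 = 1 - s ->
  T *m X = mean c *: X + (2 * alpha * beta) *: (N *m X).
Proof.
move=> SX c2; have CX : (1%:M - S) *m X = c ^+ 2 *: X.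
  by rewrite (mulmxBl _ S) mul1mx SX c2 scalerBl scale1r.
rewrite aamr_decomposition 2!mulmxDl mul_scalar_mx -!scalemxAl CX scalerA.
by rewrite -scalerDl.
Qed.

Lemma pturn_sqr_disc p (X : 'M[R]_(n, p)) s c : S *m X = s *: X ->
  c ^+ 2 = 1 - s -> N *m (N *m X) = (c ^+ 2 * disc c) *: X.
Proof.
move=> SX c2; rewrite (pturn_sqr_eigen _ _ SX) ?projmx_idem //.
have -> : s = 1 - c ^+ 2 by rewrite c2; ring.
by congr (_ *: _); rewrite /block_disc; ring.
Qed.

Lemma psin2_comm_pturn p (X : 'M[R]_(n, p)) s : S *m X = s *: X ->
  S *m (N *m X) = s *: (N *m X).
Proof.
by move=> SX; apply: psin2_eigen_comm => //; apply: psin2_comm_turn;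
  exact: projmx_idem.
Qed.

(** The square of w is real, so w is real or purely imaginary according to the
    sign of the discriminant.  In the first case the mean is nonnegative and
    the modulus is at most the sum of the mean and 2 alpha beta |w|; in the
    second case the squared modulus is the determinant. *)
Lemma block_modulus (c : R) (w : R[i]) : 0 <= c ->
  w ^+ 2 = (c ^+ 2 * disc c)%:C%C ->
  let l := ((mean c)%:C + (2 * alpha * beta)%:C * w)%C in
  modulus l <= radius c /\ (disc c < 0 -> modulus l = radius c).
Proof.
have [[a0 a1] [b0 b1]] := (andP halpha, andP hbeta).
have k0 : 0 < 2 * alpha * beta by rewrite !mulr_gt0.
move=> c0; case: w => a b; rewrite expr2; simpc => -[h1 h2] l.
have lE : modulus l = Num.sqrt ((mean c + 2 * alpha * beta * a) ^+ 2 +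
    (2 * alpha * beta * b) ^+ 2) by rewrite /l modulusE; simpc.
have /eqP : a * b = 0 by lra.
rewrite mulf_eq0 => ab0.
rewrite lE /block_radius; have [hd|hd] := ltP (disc c) 0.
  suff -> : (mean c + 2 * alpha * beta * a) ^+ 2 + (2 * alpha * beta * b) ^+ 2
    = block_det alpha beta c by [].
  have cd : c ^+ 2 * disc c <= 0 by rewrite mulr_ge0_le0 ?sqr_ge0 // ltW.
  have a00 : a = 0.
    case/orP: ab0 => /eqP // b00; apply/eqP; rewrite -sqrf_eq0 eq_le sqr_ge0 andbT.
    by rewrite expr2; move: h1; rewrite b00 mulr0 subr0 => ->.
  have b2 : b ^+ 2 = - (c ^+ 2 * disc c) by rewrite -h1 a00; ring.
  rewrite a00 mulr0 addr0 [(_ * b) ^+ 2]exprMn b2.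
  by rewrite /block_mean /block_det /block_disc; ring.
split=> //; have cd : 0 <= c ^+ 2 * disc c by rewrite mulr_ge0 ?sqr_ge0.
have b00 : b = 0.
  case/orP: ab0 => /eqP // a00; apply/eqP; rewrite -sqrf_eq0 eq_le sqr_ge0 andbT.
  by rewrite expr2; move: h1 cd; rewrite a00 mulr0 sub0r => <-; rewrite oppr_ge0.
have aE : `|a| = c * Num.sqrt (disc c).
  have aa : a * a = c ^+ 2 * disc c by rewrite -h1 b00 mulr0 subr0.
  by rewrite -sqrtr_sqr expr2 aa sqrtrM ?sqr_ge0 // sqrtr_sqr ger0_norm.
rewrite b00 mulr0 expr0n addr0 sqrtr_sqr; apply: le_trans (ler_normD _ _) _.
rewrite ger0_norm ?(block_mean_ge0 halpha) // lerD2l normrM aE gtr0_norm //.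
by rewrite mulrA.
Qed.

(** The projector onto the intersection of the orthogonal complements kills P
    and Q, hence S, whose range contains X. *)
Lemma Pinf_psin2 p (X : 'M[R]_(n, p)) s :
  s != 0 -> S *m X = s *: X -> Pinf *m X = 0.
Proof.
move=> s0 SX; have PW W : (orthoc U :&: orthoc V <= orthoc W)%VS ->
    Pinf *m projmx W = 0.
  move=> UVW; rewrite -[Pinf]projmx_sym -[projmx W]projmx_sym -trmx_mul.
  rewrite -[RHS]trmx0; congr (_^T); apply: mulmx_cV_inj => x.
  rewrite mul0mx -mulmxA; apply/projmx_orthoc/(subvP UVW).
  by have [] := projmx_memP (orthoc U :&: orthoc V)%VS x.
apply/eqP; rewrite -(inj_eq (scalerI s0)) scaler0 scalemxAr -SX mulmxA.
rewrite psin2E ?projmx_idem // !mulmxBr mulmxDr !mulmxA.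
by rewrite !PW ?capvSl ?capvSr // !mul0mx addr0 !subr0 mul0mx.
Qed.

Lemma Pinf_id p (X : 'M[R]_(n, p)) :
  P *m X = 0 -> Q *m X = 0 -> Pinf *m X = X.
Proof.
move=> PX QX; apply/matrixP => i j.
suff : Pinf *m col j X = col j X by rewrite mulmx_col => /matrixP/(_ i 0); rewrite !mxE.
by apply: projmx_id; rewrite memv_cap; apply/andP; split;
  apply/projmx_orthoc; rewrite mulmx_col (PX, QX) col0.
Qed.

Lemma aamr_on_cap p (X : 'M[R]_(n, p)) :
  P *m X = X -> Q *m X = X -> T *m X = rho *: X.
Proof.
move=> PX QX.
have h (A : 'M[R]_n) : A *m X = X -> ((2 * beta) *: A - 1%:M) *m X = (2 * beta - 1) *: X.
  by move=> AX; rewrite mulmxBl -scalemxAl AX mul1mx scalerBl scale1r.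
rewrite /aamr mulmxDl mul_scalar_mx -scalemxAl -mulmxA h // -scalemxAr h //.
by rewrite !scalerA -scalerDl; congr (_ *: _); ring.
Qed.

Lemma aamr_on_orthoc p (X : 'M[R]_(n, p)) :
  P *m X = 0 -> Q *m X = 0 -> T *m X = X.
Proof.
move=> PX QX.
have h (A : 'M[R]_n) : A *m X = 0 -> ((2 * beta) *: A - 1%:M) *m X = - X.
  by move=> AX; rewrite mulmxBl -scalemxAl AX mul1mx scaler0 sub0r.
rewrite /aamr mulmxDl mul_scalar_mx -scalemxAl -mulmxA h // mulmxN h // opprK.
by rewrite -scalerDl subrK scale1r.
Qed.

Lemma rmorph_mx_eigen p (A : 'M[R]_n) (X : 'M[R]_(n, p)) (l : R) :
  A *m X = l *: X -> C A *m C X = l%:C%C *: C X.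
Proof. by move=> AX; rewrite -map_mxM AX map_mxZ. Qed.

(** On the kernel of S, P and Q coincide; the part in U and V is multiplied by
    rho, and the rest, which is the limit, is fixed. *)
Lemma decays_psin2_ker (X : 'M[R]_n) mu : S *m X = 0 -> rho <= mu ->
  decays (fun k => C T ^+ k *m C X - C Pinf *m C X) mu.
Proof.
move=> SX rmu; have PQX := psin2_ker SX.
have PPX : P *m (P *m X) = P *m X by rewrite mulmxA projmx_idem.
have QPX : Q *m (P *m X) = P *m X by rewrite PQX mulmxA projmx_idem.
have PY : P *m (X - P *m X) = 0 by rewrite mulmxBr PPX subrr.
have QY : Q *m (X - P *m X) = 0 by rewrite mulmxBr QPX -PQX subrr.
have PinfX : Pinf *m X = X - P *m X.
  rewrite -(Pinf_id PY QY) mulmxBr.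
  suff -> : Pinf *m (P *m X) = 0 by rewrite subr0.
  have : P *m Pinf = 0.
    apply: mulmx_cV_inj => x; rewrite mul0mx -mulmxA; apply/projmx_orthoc.
    by apply: (subvP (capvSl _ (orthoc V))); have [] := projmx_memP (orthoc U :&: orthoc V)%VS x.
  by move/(congr1 trmx); rewrite trmx_mul !projmx_sym trmx0 mulmxA => ->; rewrite mul0mx.
apply: (@decays_eq _ _ _ (fun k => C T ^+ k *m C (P *m X))) => [k|].
  have XE : C X = C (X - P *m X) + C (P *m X) by rewrite -map_mxD subrK.
  rewrite -map_mxM PinfX XE mulmxDr.
  have -> : C T ^+ k *m C (X - P *m X) = C (X - P *m X).
    rewrite (@mulmx_expr_eigen _ _ _ _ _ 1) ?expr1n ?scale1r //.
    by rewrite -map_mxM aamr_on_orthoc // scale1r.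
  by rewrite addrAC subrr add0r.
apply: decays_eigen (rmorph_mx_eigen (aamr_on_cap PPX QPX)) _.
by rewrite modulus_real ger0_norm // (rho_ge0 halpha).
Qed.

(** A factorization of the quadratic into its two roots, valid for either choice
    of the square root [w], and also for a double root. *)
Lemma block_factorization p (X : 'M[R]_(n, p)) s c (w : R[i]) :
  S *m X = s *: X -> c ^+ 2 = 1 - s -> w ^+ 2 = (c ^+ 2 * disc c)%:C%C ->
  let k := (2 * alpha * beta)%:C%C in
  let Y := k *: (C N *m C X + w *: C X) in
  C T *m C X = ((mean c)%:C%C + k * - w) *: C X + Y /\
  C T *m Y = ((mean c)%:C%C + k * w) *: Y.
Proof.
move=> SX c2 w2 k Y.
have TX : C T *m C X = (mean c)%:C%C *: C X + k *: (C N *m C X).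
  by rewrite -map_mxM (aamr_eigen SX c2) map_mxD !map_mxZ map_mxM.
have TNX : C T *m (C N *m C X) = (mean c)%:C%C *: (C N *m C X) + (k * w ^+ 2) *: C X.
  rewrite -map_mxM -map_mxM (aamr_eigen (psin2_comm_pturn SX) c2).
  by rewrite (pturn_sqr_disc SX c2) map_mxD !map_mxZ map_mxM w2 -scalerA.
split.
  rewrite TX /Y; move: (C N *m C X) (C X) => A B.
  by apply/matrixP => i j; rewrite !mxE; ring.
rewrite /Y -!scalemxAr mulmxDr -scalemxAr TX TNX; move: (C N *m C X) (C X) => A B.
by apply/matrixP => i j; rewrite !mxE; ring.
Qed.

(** A double root calls for a rate larger than its modulus, except for c = 0:
    there J vanishes, hence N does too, and T is a scalar. *)
Lemma decays_block (X : 'M[R]_n) s c mu : S *m X = s *: X -> c ^+ 2 = 1 - s ->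
  0 <= c < 1 -> radius c <= mu -> (c != 0 -> disc c = 0 -> radius c < mu) ->
  decays (fun k => C T ^+ k *m C X - C Pinf *m C X) mu.
Proof.
move=> SX c2 /andP[c0 c1] rmu rlt.
have sN0 : s != 0.
  apply/eqP => s0; move: c1; rewrite -(@ltr_pXn2r _ 2) ?nnegrE // c2 s0 subr0 expr1n.
  by rewrite ltxx.
apply: (@decays_eq _ _ _ (fun k => C T ^+ k *m C X)) => [k|].
  by rewrite -map_mxM (Pinf_psin2 sN0 SX) map_mx0 subr0.
pose w := sqrtC (c ^+ 2 * disc c)%:C%C.
have w2 : w ^+ 2 = (c ^+ 2 * disc c)%:C%C by rewrite sqrtCK.
have Nw2 : (- w) ^+ 2 = (c ^+ 2 * disc c)%:C%C by rewrite sqrrN.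
have [TX TY] := block_factorization SX c2 w2.
have [m1 _] := block_modulus c0 w2; have [m2 _] := block_modulus c0 Nw2.
have [c00|cN0] := eqVneq c 0.
  have JX : pcosum P Q *m X = 0.
    apply: symmetric_sqr_ker; first by apply: pcosum_sym; exact: projmx_sym.
    by rewrite -mulmxA (pcosum_sqr_eigen _ _ SX) ?projmx_idem // -c2 c00 expr0n scale0r.
  have TX0 : T *m X = mean c *: X.
    by rewrite (aamr_eigen SX c2) /pturn -mulmxA JX mulmx0 scaler0 addr0.
  apply: decays_eigen (rmorph_mx_eigen TX0) _; apply: le_trans rmu.
  have := m1; rewrite (_ : w = 0) ?mulr0 ?addr0 //.
  by apply/eqP; rewrite -sqrf_eq0 w2 c00 expr0n mul0r.
have [d0|dN0] := eqVneq (disc c) 0.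
  have rl := rlt cN0 d0.
  by apply: decays_roots_lt TX TY _ _; [exact: le_lt_trans m1 rl | exact: le_lt_trans m2 rl].
apply: decays_simple_roots TX TY _ (le_trans m1 rmu) (le_trans m2 rmu).
rewrite (inj_eq (addrI _)) mulrN -addr_eq0 -mulr2n mulrn_eq0 /= mulf_eq0 negb_or.
have [[a0 _] [b0 _]] := (andP halpha, andP hbeta).
have k0 : 2 * alpha * beta != 0 by rewrite !mulf_neq0 ?gt_eqF.
have wN0 : w != 0.
  rewrite -sqrf_eq0 w2; apply/eqP => /complexI/eqP.
  by rewrite mulf_eq0 sqrf_eq0 (negbTE cN0) (negbTE dN0).
by rewrite wN0 andbT; apply/eqP => /complexI/eqP; rewrite (negbTE k0).
Qed.

Lemma complex_sqrM (a b : R) : (a ^+ 2 * b)%:C%C = a%:C%C ^+ 2 * b%:C%C.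
Proof. by rewrite rmorphM rmorphXn. Qed.

(** A left eigenvector does not vanish on all the matrices of the resolution;
    its value on one of them is killed by the quadratic of that eigenspace. *)
Lemma aamr_spectrum rs E (l : R[i]) : spectral_resolution S rs E ->
  eigenvalue (C T) l ->
  exists2 s, s \in rs &
    let c := Num.sqrt (1 - s) in
    (l - (mean c)%:C%C) ^+ 2 = ((2 * alpha * beta) ^+ 2 * (c ^+ 2 * disc c))%:C%C.
Proof.
move=> res /eigenvalueP[v vT v0]; have [E1 hE] := res.
have [s srs vE0] : exists2 s, s \in rs & v *m C (E s) != 0.
  apply/not_exists2P => h; move/eqP: v0; apply.
  rewrite -[v]mulmx1 -(map_mx1 (real_complex R)) -E1 raddf_sum /= mulmx_sumr.
  rewrite big_seq big1 // => s srs.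
  by have [//|/negP/negPn/eqP] := h s.
exists s => // c; have [_ SE _ _] := hE s srs.
have [x Sx x0] := resolution_eigenvector res srs.
have s1 : s <= 1.
  by apply: psin2_eigen_le1 Sx x0; rewrite ?projmx_sym ?projmx_idem.
have c2 : c ^+ 2 = 1 - s by rewrite sqr_sqrtr // subr_ge0.
pose y0 := v *m C (E s); pose y1 := v *m (C N *m C (E s)).
have h0 : (l - (mean c)%:C%C) *: y0 = (2 * alpha * beta)%:C%C *: y1.
  rewrite scalerBl [l *: y0]scalemxAl -vT -mulmxA -map_mxM (aamr_eigen SE c2).
  by rewrite map_mxD !map_mxZ mulmxDr -!scalemxAr addrAC subrr add0r map_mxM.
have h1 : (l - (mean c)%:C%C) *: y1
    = (2 * alpha * beta)%:C%C *: ((c ^+ 2 * disc c)%:C%C *: y0).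
  rewrite scalerBl [l *: y1]scalemxAl -vT /y1 -map_mxM -mulmxA -map_mxM.
  rewrite (aamr_eigen (psin2_comm_pturn SE) c2) (pturn_sqr_disc SE c2).
  by rewrite map_mxD !map_mxZ mulmxDr -!scalemxAr addrAC subrr add0r.
apply/eqP; rewrite -subr_eq0.
have : ((l - (mean c)%:C%C) ^+ 2 -
    ((2 * alpha * beta) ^+ 2 * (c ^+ 2 * disc c))%:C%C) *: y0 = 0.
  rewrite scalerBl expr2 -scalerA h0 scalerA mulrC -scalerA h1.
  by rewrite complex_sqrM expr2 !scalerA subrr.
by move/eqP; rewrite scaler_eq0 (negbTE vE0) orbF.
Qed.

Lemma block_root_modulus c (l : R[i]) : 0 <= c ->
  (l - (mean c)%:C%C) ^+ 2 = ((2 * alpha * beta) ^+ 2 * (c ^+ 2 * disc c))%:C%C ->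
  modulus l <= radius c.
Proof.
move=> c0 hl; pose k := (2 * alpha * beta)%:C%C.
have [[a0 _] [b0 _]] := (andP halpha, andP hbeta).
have k0 : k != 0 by apply/eqP => /complexI/eqP; rewrite !mulf_eq0 !gt_eqF // pnatr_eq0.
have w2 : (k^-1 * (l - (mean c)%:C%C)) ^+ 2 = (c ^+ 2 * disc c)%:C%C.
  by rewrite exprMn hl complex_sqrM -/k mulrA -exprMn mulVf // expr1n mul1r.
have [] := block_modulus c0 w2.
by rewrite /= -/k mulrA divff // mul1r addrC subrK.
Qed.

Lemma block_root_at1 (l : R[i]) :
  (l - (mean 1)%:C%C) ^+ 2 = ((2 * alpha * beta) ^+ 2 * (1 ^+ 2 * disc 1))%:C%C ->
  l = 1 \/ l = rho%:C%C.
Proof.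
have -> : (2 * alpha * beta) ^+ 2 * (1 ^+ 2 * disc 1) =
    (2 * alpha * beta * (1 - beta)) ^+ 2 by rewrite /block_disc; ring.
rewrite rmorphXn /= => /eqP; rewrite eqf_sqr => /orP[] /eqP /(canRL (subrK _)) ->.
  by left; rewrite -rmorphD /= -(rmorph1 (real_complex R)); congr (_%:C)%C;
    rewrite /block_mean; ring.
by right; rewrite -rmorphN -rmorphD /=; congr (_%:C)%C; rewrite /block_mean; ring.
Qed.

(** Non-real roots have the same modulus, so any eigenvalue on the eigenspace
    will do.  If the roots are real, the larger one must be reached: as N is
    not the scalar - w, some N y + w y is nonzero, and it is an eigenvector of
    N for w. *)
Lemma block_radius_attained s c (x : 'cV[R]_n) : S *m x = s *: x -> x != 0 ->
  0 < s -> c ^+ 2 = 1 - s -> 0 <= c ->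
  exists (l : R[i]) (z : 'cV[R[i]]_n),
    [/\ C T *m z = l *: z, z != 0 & modulus l = radius c].
Proof.
move=> Sx x0 s0 c2 c0.
have [[a0 a1] [b0 b1]] := (andP halpha, andP hbeta).
have Cx0 (y : 'cV[R]_n) : y != 0 -> C y != 0 by rewrite map_mx_eq0.
have s1 : s <= 1 by rewrite -subr_ge0 -c2 sqr_ge0.
have [c00|cN0] := eqVneq c 0.
  have Jx : pcosum P Q *m x = 0.
    apply: symmetric_sqr_ker; first by apply: pcosum_sym; exact: projmx_sym.
    by rewrite -mulmxA (pcosum_sqr_eigen _ _ Sx) ?projmx_idem // -c2 c00 expr0n scale0r.
  have Tx : T *m x = mean c *: x.
    by rewrite (aamr_eigen Sx c2) /pturn -mulmxA Jx mulmx0 scaler0 addr0.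
  exists (mean c)%:C%C, (C x); split; [exact: rmorph_mx_eigen | exact: Cx0 |].
  rewrite modulus_real /block_radius; case: (ltP (disc c) 0) => hd.
    rewrite -sqrtr_sqr; congr Num.sqrt; rewrite /block_mean /block_det c00; ring.
  by rewrite ger0_norm ?(block_mean_ge0 halpha) // c00 mulr0 mul0r addr0.
have s1' : s < 1.
  by rewrite lt_neqAle s1 andbT; apply: contra cN0 => /eqP s1'; rewrite -sqrf_eq0 c2 s1' subrr.
have [hd|hd] := ltP (disc c) 0.
  pose w := sqrtC (c ^+ 2 * disc c)%:C%C.
  have w2 : w ^+ 2 = (c ^+ 2 * disc c)%:C%C by rewrite sqrtCK.
  have Nw2 : (- w) ^+ 2 = (c ^+ 2 * disc c)%:C%C by rewrite sqrrN.
  have [TX TY] := block_factorization Sx c2 w2.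
  have [_ m1] := block_modulus c0 w2; have [_ m2] := block_modulus c0 Nw2.
  set Y := (_ *: (C N *m C x + _)) in TX TY.
  have [Y0|Y0] := eqVneq Y 0.
    rewrite Y0 addr0 in TX.
    by eexists; eexists; split; [exact: TX | exact: Cx0 | exact: m2].
  by eexists; eexists; split; [exact: TY | exact: Y0 | exact: m1].
have cp : 0 < c by rewrite lt_def cN0.
pose w := c * Num.sqrt (disc c).
have w2 : w ^+ 2 = c ^+ 2 * disc c by rewrite exprMn sqr_sqrtr.
have [y Sy Ny] : exists2 y : 'cV[R]_n, S *m y = s *: y & N *m y != - w *: y.
  by apply: (pturn_not_scalar (projmx_idem _) (projmx_idem _) Sx x0); rewrite ?s0.
pose z := N *m y + w *: y.
have z0 : z != 0 by rewrite /z addr_eq0 -scaleNr.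
have Tz : T *m z = (mean c + 2 * alpha * beta * w) *: z.
  have Sz : S *m z = s *: z.
    by rewrite mulmxDr -scalemxAr (psin2_comm_pturn Sy) Sy scalerDr !scalerA mulrC.
  rewrite (aamr_eigen Sz c2) [RHS]scalerDl -[in RHS]scalerA; congr (_ + _ *: _).
  rewrite /z mulmxDr -scalemxAr (pturn_sqr_disc Sy c2) -w2 scalerDr scalerA addrC.
  by rewrite expr2.
exists (mean c + 2 * alpha * beta * w)%:C%C, (C z).
split; [exact: rmorph_mx_eigen | exact: Cx0 |].
rewrite modulus_real ger0_norm.
  by rewrite /block_radius ltNge hd /= /w mulrA.
by rewrite addr_ge0 ?(block_mean_ge0 halpha) // !mulr_ge0 ?sqrtr_ge0 // ltW.
Qed.

(** Here N^2 = 0 on the eigenspace, whereas N itself is not zero there. *)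
Lemma block_jordan_chain s c (x : 'cV[R]_n) : S *m x = s *: x -> x != 0 ->
  0 < s < 1 -> c ^+ 2 = 1 - s -> disc c = 0 ->
  exists v z : 'cV[R[i]]_n,
    [/\ C T *m v = (mean c)%:C%C *: v + z, C T *m z = (mean c)%:C%C *: z & z != 0].
Proof.
move=> Sx x0 s01 c2 d0.
have [[a0 a1] [b0 b1]] := (andP halpha, andP hbeta).
have [y Sy Ny] : exists2 y : 'cV[R]_n, S *m y = s *: y & N *m y != 0 *: y.
  exact: (pturn_not_scalar (projmx_idem _) (projmx_idem _) Sx x0).
have w2 : (0 : R[i]) ^+ 2 = (c ^+ 2 * disc c)%:C%C by rewrite d0 mulr0 expr0n.
have [] := block_factorization Sy c2 w2.
rewrite oppr0 scale0r !addr0 mulr0 addr0; set k := (2 * _ * _)%:C%C => TX TY.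
exists (C y), (k *: (C N *m C y)); split=> //.
rewrite scaler_eq0 negb_or -map_mxM map_mx_eq0; apply/andP; split.
  by apply/eqP => /complexI/eqP; rewrite !mulf_eq0 !gt_eqF // pnatr_eq0.
by move: Ny; rewrite scale0r.
Qed.

End AAMRBlocks.

(** * Spectrum, rates and optimality *)

Lemma eigenvalue_of_col_eigenvector {F : fieldType} {n : nat} (A : 'M[F]_n) (x : 'cV[F]_n) l :
  A *m x = l *: x -> x != 0 -> eigenvalue A l.
Proof.
move=> Ax; apply: contraR; rewrite negbK kermx_eq0 row_free_unit => Au.
by rewrite -[x](mulKmx Au) mulmxBl Ax mul_scalar_mx subrr mulmx0.
Qed.

Lemma sup_eq_maximum {R : realType} (A : set R) (m : R) :
  A m -> ubound A m -> sup A = m.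
Proof.
move=> Am ubm; apply/eqP; rewrite eq_le; apply/andP; split.
  by apply: ge_sup => //; exists m.
by apply: ub_le_sup => //; exists m.
Qed.

Lemma inf_eq_minimum {R : realType} (A : set R) (m : R) :
  A m -> lbound A m -> inf A = m.
Proof.
move=> Am lbm; apply/eqP; rewrite eq_le; apply/andP; split.
  by apply: ge_inf => //; exists m.
by apply: lb_le_inf => //; exists m.
Qed.

Lemma seq_has_minimum {R : realDomainType} (rs : seq R) :
  rs != [::] -> exists2 m, m \in rs & forall r, r \in rs -> m <= r.
Proof.
elim: rs => // a rs IH _; have [->|/IH[m mrs hm]] := eqVneq rs [::].
  by exists a => [|r]; rewrite inE // => /eqP ->.
have [am|ma] := leP a m.
  exists a => [|r]; rewrite inE ?eqxx // => /predU1P[->|/hm] //.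
  exact: le_trans.
exists m => [|r]; first by rewrite inE mrs orbT.
by rewrite inE => /predU1P[->|/hm] //; exact: ltW.
Qed.

Lemma gamma_eq_maximum {R : realType} {n : nat} (A : 'M[R[i]]_n) (m : R) :
  (exists l, [/\ eigenvalue A l, l != 1 & modulus l = m]) ->
  (forall l, eigenvalue A l -> l != 1 -> modulus l <= m) ->
  gamma A = m.
Proof.
move=> [l [Al l1 lm]] ubm; apply: sup_eq_maximum.
  by exists l => //; right; split => //; exact/eqP.
move=> _ [z zA <-]; case: zA => [->|[Az /eqP z1]]; last exact: ubm.
by rewrite modulus0 -lm modulus_ge0.
Qed.

Section AAMRGlobal.
Context {R : realType} {n : nat}.
Variables (alpha beta : R) (U V : {vspace 'cV[R]_n}).
Hypotheses (halpha : 0 < alpha <= 1) (hbeta : 0 < beta < 1).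
Variables (rs : seq R) (E : R -> 'M[R]_n) (s : R).
Hypothesis res : spectral_resolution (psin2 (projmx U) (projmx V)) rs E.
Hypotheses (srs : s \in rs) (s0 : 0 < s).
Hypothesis smin : forall r, r \in rs -> r != 0 -> s <= r.
Hypothesis hUV0 : (U :&: V)%VS <> 0%VS.

Local Notation P := (projmx U).
Local Notation Q := (projmx V).
Local Notation S := (psin2 P Q).
Local Notation disc := (block_disc beta).
Local Notation radius := (block_radius alpha beta).
Local Notation rho := (1 - 4 * alpha * beta * (1 - beta)).
Local Notation c := (Num.sqrt (1 - s)).
Local Notation C := (map_mx (real_complex R)).
Local Notation T := (C (aamr alpha beta U V)).
Local Notation Pinf := (C (projmx (orthoc U :&: orthoc V)%VS)).

Lemma resolution_range r : r \in rs -> 0 <= r <= 1.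
Proof.
move=> /(resolution_eigenvector res)[x Sx x0]; apply/andP; split.
  by apply: psin2_eigen_ge0 Sx x0; rewrite ?projmx_sym.
by apply: psin2_eigen_le1 Sx x0; rewrite ?projmx_sym ?projmx_idem.
Qed.

Lemma resolution_cos_le r : r \in rs -> r != 0 -> 0 <= Num.sqrt (1 - r) <= c.
Proof.
move=> rrs r0; rewrite sqrtr_ge0 ler_wsqrtr // lerD2l lerN2.
exact: smin.
Qed.

Lemma sqrt_onem_lt1 : 0 <= c < 1.
Proof.
rewrite sqrtr_ge0 /=; apply: (@lt_le_trans _ _ (Num.sqrt 1)); last by rewrite sqrtr1.
by rewrite ltr_sqrt ?ltr01 // ltrBlDr ltrDl.
Qed.

Lemma sqr_sqrt_onem : c ^+ 2 = 1 - s.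
Proof. by rewrite sqr_sqrtr // subr_ge0; have /andP[] := resolution_range srs. Qed.

Lemma aamr_eigenvalue_le l :
  eigenvalue T l -> l != 1 -> modulus l <= Num.max rho (radius c).
Proof.
move=> Tl l1; have [r rrs] := aamr_spectrum res Tl; rewrite le_max.
have [->|r0] := eqVneq r 0.
  rewrite subr0 sqrtr1 => /block_root_at1[l1'|->].
    by rewrite l1' eqxx in l1.
  by rewrite modulus_real ger0_norm ?lexx ?(rho_ge0 halpha).
have /andP[cr0 crc] := resolution_cos_le rrs r0.
move=> /(block_root_modulus halpha hbeta cr0) => lr; apply/orP; right.
exact: le_trans lr (block_radius_le halpha hbeta cr0 crc).
Qed.

Lemma aamr_rho_eigenvector : exists2 x : 'cV[R[i]]_n, T *m x = rho%:C%C *: x & x != 0.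
Proof.
pose x := vpick (U :&: V)%VS; have := memv_pick (U :&: V)%VS.
rewrite memv_cap -/x => /andP[/projmx_id xU /projmx_id xV].
exists (C x); first by apply: rmorph_mx_eigen; apply: aamr_on_cap.
by rewrite map_mx_eq0 vpick0; apply/eqP.
Qed.

Lemma max_rate_lt1 : Num.max rho (radius c) < 1.
Proof. by rewrite gt_max (rho_lt1 halpha) // (block_radius_lt1 halpha) // sqrt_onem_lt1. Qed.

Lemma max_rate_ge0 : 0 <= Num.max rho (radius c).
Proof. by rewrite le_max (rho_ge0 halpha). Qed.

Lemma aamr_extreme_eigenvector : exists (l : R[i]) (x : 'cV[R[i]]_n),
  [/\ T *m x = l *: x, x != 0, l != 1 & modulus l = Num.max rho (radius c)].
Proof.
have neq1 (l : R[i]) : modulus l = Num.max rho (radius c) -> l != 1.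
  move=> lm; apply/eqP => l1; move: lm max_rate_lt1; rewrite l1 modulus1 => <-.
  by rewrite ltxx.
have [cr|rc] := leP (radius c) rho.
  have [x Tx x0] := aamr_rho_eigenvector.
  have ml : modulus rho%:C%C = rho by rewrite modulus_real ger0_norm ?(rho_ge0 halpha).
  exists rho%:C%C, x; split=> //; apply: neq1; rewrite ml max_l //.
have [x Sx x0] := resolution_eigenvector res srs.
have [l [z [Tz z0 lm]]] := block_radius_attained halpha hbeta Sx x0 s0 sqr_sqrt_onem (sqrtr_ge0 _).
by exists l, z; split=> //; apply: neq1; rewrite lm max_r // ltW.
Qed.

Lemma gamma_aamr : gamma T = Num.max rho (radius c).
Proof.
apply: gamma_eq_maximum aamr_eigenvalue_le.
have [l [x [Tx x0 l1 lm]]] := aamr_extreme_eigenvector.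
by exists l; split=> //; exact: eigenvalue_of_col_eigenvector Tx x0.
Qed.

(** A double root inside the resolution is harmless below the Friedrichs cosine,
    because the radius increases strictly from a cosine with zero
    discriminant. *)
Lemma aamr_decays mu : rho <= mu -> radius c <= mu ->
  (c != 0 -> disc c = 0 -> radius c < mu) ->
  decays (fun k => T ^+ k - Pinf) mu.
Proof.
move=> rmu cmu jmu.
apply: (@decays_eq _ _ _ (fun k => \sum_(r <- rs) (T ^+ k *m C (E r) - Pinf *m C (E r)))).
  move=> k; under eq_bigr do rewrite -mulmxBl.
  rewrite -mulmx_sumr -[RHS]mulmx1; congr (_ *m _).
  by rewrite -(map_mx1 (real_complex R)) -res.1 raddf_sum.
apply: decays_sum => r rrs; have [_ SE _ _] := res.2 r rrs.
have [r0|rN0] := eqVneq r 0.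
  by apply: decays_psin2_ker; rewrite // SE r0 scale0r.
have /andP[cr0 crc] := resolution_cos_le rrs rN0.
have /andP[_ r1] := resolution_range rrs; have /andP[_ c1] := sqrt_onem_lt1.
have radle := block_radius_le halpha hbeta cr0 crc.
apply: (decays_block halpha hbeta SE (_ : Num.sqrt (1 - r) ^+ 2 = 1 - r)) => //.
- by rewrite sqr_sqrtr ?subr_ge0.
- by rewrite cr0 (le_lt_trans crc).
- exact: le_trans radle cmu.
move=> crN0 d0; move: crc; rewrite le_eqVlt => /predU1P[crE|crlt].
  by rewrite crE; apply: jmu; rewrite -crE.
apply: lt_le_trans cmu; apply: (block_radius_lt halpha) => //.
by rewrite d0.
Qed.

Lemma aamr_linearly_convergent mu : gamma T < mu < 1 ->
  linearly_convergent T Pinf mu.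
Proof.
rewrite gamma_aamr gt_max => /andP[/andP[rmu cmu] mu1].
apply: linearly_convergent_decays.
  by rewrite mu1 andbT (le_trans _ (ltW rmu)) ?(rho_ge0 halpha).
by apply: aamr_decays; rewrite ?ltW.
Qed.

Lemma gamma_lbound : lbound (convergence_rates T) (gamma T).
Proof.
move=> mu [Ainf cvgT]; rewrite gamma_aamr.
have [l [x [Tx x0 l1 <-]]] := aamr_extreme_eigenvector.
exact: rate_ge_modulus cvgT Tx x0 l1.
Qed.

(** gamma T is always a lower bound of the rates, so optimality means that it is
    a rate.  This fails only for a Jordan block of modulus gamma T, which can
    only come from the Friedrichs cosine. *)
Lemma optimal_rate_gammaE :
  optimal_rate T (gamma T) <-> (disc c <> 0 \/ c = 0).
Proof.
split=> [[[Ainf cvgT] _]|h].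
  have [->|c0] := eqVneq c 0; [by right | left => d0].
  have [x Sx x0] := resolution_eigenvector res srs.
  have s1 : s < 1.
    have /andP[_] := resolution_range srs; rewrite le_eqVlt => /predU1P[s1|//].
    by rewrite s1 subrr sqrtr0 eqxx in c0.
  have s01 : 0 < s < 1 by rewrite s0.
  have [v [z [Tv Tz z0]]] := block_jordan_chain halpha hbeta Sx x0 s01 sqr_sqrt_onem d0.
  have rE : radius c = block_mean alpha beta c.
    by rewrite /block_radius d0 ltxx sqrtr0 mulr0 addr0.
  have mean0 := block_mean_gt0 halpha hbeta c0 d0.
  have gE : gamma T = modulus (block_mean alpha beta c)%:C%C.
    rewrite gamma_aamr modulus_real gtr0_norm // max_r ?rE //.
    by rewrite (rho_le_mean halpha) // d0.
  apply: (jordan_modulus_not_rate Tv Tz z0 _ _ (_ : linearly_convergent T Ainf _)).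
  - by apply/eqP => /complexI/eqP; rewrite gt_eqF.
  - apply/eqP => /complexI m1; have := max_rate_lt1.
    by rewrite rE m1 gt_max ltxx andbF.
  - by rewrite -gE.
have rate : convergence_rates T (gamma T).
  exists Pinf; apply: linearly_convergent_decays.
    by rewrite gamma_aamr max_rate_ge0 max_rate_lt1.
  rewrite gamma_aamr; apply: aamr_decays; rewrite ?le_max ?lexx ?orbT //.
  by move=> /eqP c0 d0; case: h.
by split=> //; apply/esym/inf_eq_minimum => //; exact: gamma_lbound.
Qed.

End AAMRGlobal.

(** The discriminant is (1 - beta)^2 - (beta q)^2, and 1 - beta + beta q > 0. *)
Lemma block_disc_sin {R : realType} (beta c q : R) :
  0 < beta < 1 -> 0 <= q -> c ^+ 2 = 1 - q ^+ 2 ->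
  block_disc beta c = 0 <-> beta = 1 / (1 + q).
Proof.
move=> /andP[b0 b1] q0 c2.
have -> : block_disc beta c = (1 - beta * (1 + q)) * (1 - beta + beta * q).
  by rewrite /block_disc c2; ring.
have q1 : 1 + q != 0 by rewrite gt_eqF // ltr_wpDr.
have f0 : 1 - beta + beta * q != 0.
  by rewrite gt_eqF // ltr_wpDr ?subr_gt0 // mulr_ge0 // ltW.
split=> [/eqP|->]; last by rewrite div1r mulVf // subrr mul0r.
rewrite mulf_eq0 (negbTE f0) orbF subr_eq0 => /eqP h.
by apply: (mulIf q1); rewrite divfK.
Qed.

Lemma spectral_min_exists {R : realType} {n : nat} (S : 'M[R]_n) rs E :
  spectral_resolution S rs E -> S != 0 ->
  (forall r, r \in rs -> 0 <= r) ->
  exists s, [/\ s \in rs, 0 < s & forall r, r \in rs -> r != 0 -> s <= r].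
Proof.
move=> [E1 hE] S0 rs0.
have [|s] := @seq_has_minimum R [seq r <- rs | r != 0].
  apply: contra S0 => /eqP rs00; rewrite -[S]mulmx1 -E1 mulmx_sumr big_seq.
  apply/eqP/big1 => r rrs; have [_ -> _ _] := hE r rrs.
  have : r \notin [seq r <- rs | r != 0] by rewrite rs00.
  by rewrite mem_filter rrs andbT negbK => /eqP ->; rewrite scale0r.
rewrite mem_filter => /andP[sN0 srs] smin; exists s; split=> //.
  by rewrite lt_def sN0 rs0.
by move=> r rrs rN0; apply: smin; rewrite mem_filter rN0.
Qed.

Theorem theorem3p1 (R : realType) (n : nat) (alpha beta : R)
    (U V : {vspace 'cV[R]_n})
    (halpha : 0 < alpha <= 1) (hbeta : 0 < beta < 1)
    (hdimU : (1 <= \dim U)%N) (hdimUV : (\dim U <= \dim V)%N)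
    (hdimV : (\dim V <= n - 1)%N)
    (hUV : U <> (U :&: V)%VS) (hUV0 : (U :&: V)%VS <> 0%VS) :
  let thetaF := friedrichs_angle U V in
  let cF := cos thetaF in
  let T := map_mx (real_complex R) (aamr alpha beta U V) in
  let Pinf := map_mx (real_complex R) (projmx (orthoc U :&: orthoc V)%VS) in
  [/\ forall mu : R, gamma T < mu < 1 -> linearly_convergent T Pinf mu,
      gamma T = aamr_rate alpha beta cF &
      optimal_rate T (gamma T) <->
        (beta <> 1 / (1 + sin thetaF) \/ thetaF = pi / 2)].
Proof.
case: n U V hdimU hdimUV hdimV hUV hUV0 => [|n] U V hdimU hdimUV hdimV hUV hUV0.
  by have := leq_trans hdimU (leq_trans hdimUV hdimV).
set S := psin2 (projmx U) (projmx V).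
have Ssym : S^T = S by apply: psin2_sym; exact: projmx_sym.
have [rs [E res]] := symmetric_spectral_resolution Ssym.
(* S = 0 would make the two projectors equal, so U would lie in V. *)
have SN0 : S != 0.
  apply/eqP => S0; apply: hUV; apply/eqP; rewrite eqEsubv capvSl andbT.
  rewrite subv_cap subvv; apply/subvP => x /projmx_id xU.
  by rewrite projmx_fixE -(@psin2_ker _ _ U V) ?xU // -/S S0 mul0mx.
have rs0 r : r \in rs -> 0 <= r by move=> /(resolution_range res)/andP[].
have [s [srs s0 smin]] := spectral_min_exists res SN0 rs0.
have cE := friedrichs_cosE res srs s0 smin.
have /andP[c0 c1] := sqrt_onem_lt1 s0.
have /andP[_ s1] := resolution_range res srs.
move=> thetaF cF T Pinf.
have crange : -1 <= Num.sqrt (1 - s) <= 1 by rewrite (ltW c1) andbT (le_trans _ c0) ?lerN10.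
have cFE : cF = Num.sqrt (1 - s).
  by rewrite /cF /thetaF /friedrichs_angle cE acosK.
have sinE : sin thetaF = Num.sqrt s.
  rewrite /thetaF /friedrichs_angle cE sin_acos // sqr_sqrtr ?subr_ge0 //.
  by congr Num.sqrt; ring.
split.
- by move=> mu; exact: (aamr_linearly_convergent halpha hbeta res srs s0 smin hUV0).
- rewrite cFE aamr_rateE // (gamma_aamr halpha hbeta res srs s0 smin hUV0) //.
apply: iff_trans (optimal_rate_gammaE halpha hbeta res srs s0 smin hUV0) _.
have dE : block_disc beta (Num.sqrt (1 - s)) = 0 <-> beta = 1 / (1 + sin thetaF).
  by apply: block_disc_sin; rewrite ?sinE ?sqrtr_ge0 // !sqr_sqrtr ?subr_ge0 // ltW.
have tE : Num.sqrt (1 - s) = 0 <-> thetaF = pi / 2.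
  split=> [c00|t]; last by rewrite -cFE /cF t cos_pihalf.
  by rewrite /thetaF /friedrichs_angle cE c00 acos0.
by rewrite dE tE.
Qed.
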